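(* Let $f$ be a Dirichlet series mapping $\mathbb{C}_0$ to $\mathbb{D}$. Then \[\limsup_{T\to \infty} N_f(\xi,T) \leq \log\left|\frac{1-\overline{\xi}f(+\infty)}{\xi-f(+\infty)}\right|\] for every $\xi$ in $\mathbb{D} \setminus \{f(+\infty)\}$.
   Context: $\mathbb{C}_\kappa=\{s:\mathrm{Re}\,s>\kappa\}$ and $\mathbb{D}$ is the open unit disc. A ''Dirichlet series mapping $\mathbb{C}_0$ to $\mathbb{D}$'' is an analytic function $f:\mathbb{C}_0\to\mathbb{D}$ represented by a Dirichlet series $\sum_{n\ge1}a_nn^{-s}$ converging in $\mathbb{C}_\kappa$ for some $\kappa>0$; $f(+\infty)=a_1$. For $T>0$ and $\xi\in\mathbb{D}$, $N_f(\xi,T)=\frac{\pi}{T}\sum\mathrm{Re}\,s$, summing over all $s\in\mathbb{C}_0$ with $f(s)=\xi$ and $|\mathrm{Im}\,s|<T$, counted with multiplicity. *)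

(* Defs.v *)
From Stdlib Require Import Reals List.
From Coquelicot Require Import Coquelicot.
Open Scope R_scope.

Definition Cexp' (z : C) : C :=
  (exp (Re z) * cos (Im z), exp (Re z) * sin (Im z)).

Definition npow_neg (n : nat) (s : C) : C :=
  Cexp' (Copp s * RtoC (ln (INR n)))%C.

Definition C_differentiable (f : C -> C) (z : C) : Prop :=
  @ex_derive C_AbsRing C_NormedModule f z.

(* f : C_0 -> D is an analytic function given by the Dirichlet series
   sum_{n>=1} a n * n^{-s}, which converges (to f) on C_kappa for some kappa>0.
   The coefficient a 0 is irrelevant (the series starts at n = 1). *)
Definition dirichlet_series_C0_to_D (f : C -> C) (a : nat -> C) : Prop :=
  (forall s : C, 0 < Re s -> C_differentiable f s) /\
  (forall s : C, 0 < Re s -> Cmod (f s) < 1) /\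
  (exists kappa : R, 0 < kappa /\
     forall s : C, kappa < Re s ->
       is_series (fun n : nat => Cmult (a (S n)) (npow_neg (S n) s)) (f s)).

Definition f_at_infty (a : nat -> C) : C := a 1%nat.

Definition zero_order (g : C -> C) (s : C) (k : nat) : Prop :=
  exists h : C -> C,
    locally s (fun z => C_differentiable h z) /\
    h s <> RtoC 0 /\
    locally s (fun z => g z = Cmult (Cpow (Cminus z s) k) (h z)).

Definition finite_weighted_sum (f : C -> C) (xi : C) (T : R) (x : R) : Prop :=
  exists l : list (C * nat),
    NoDup (map fst l) /\
    (forall p, In p l ->
       0 < Re (fst p) /\ Rabs (Im (fst p)) < T /\ f (fst p) = xi /\
       zero_order (fun z => Cminus (f z) xi) (fst p) (snd p)) /\
    x = fold_right (fun p acc => INR (snd p) * Re (fst p) + acc) 0 l.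

(* N_f(xi,T) = (pi/T) * sum_{f(s)=xi, Re s>0, |Im s|<T} Re s  (with multiplicity);
   the (possibly infinite) sum of nonnegative terms is the sup of finite partial sums. *)
Definition N_f (f : C -> C) (xi : C) (T : R) : Rbar :=
  Rbar_mult (Finite (PI / T)) (Lub_Rbar (finite_weighted_sum f xi T)).

Definition limsup_pinfty (F : R -> Rbar) : Rbar :=
  Rbar_glb (fun y => exists T0 : R,
    y = Rbar_lub (fun x => exists T : R, T0 <= T /\ x = F T)).

(* Main.v *)
Require Import Defs.
From Stdlib Require Import Reals List Lra Lia Classical ClassicalEpsilon.
From Coquelicot Require Import Coquelicot.
Open Scope R_scope.

(** Compose [f] with the disc automorphism exchanging [xi] and [0] to get
    [g : C_0 -> D] whose zeros are the solutions of [f = xi].  Dividing out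
    finitely many zeros [s_k] (of multiplicity [m_k]) by Blaschke factors keeps
    [g] bounded by 1, whence, with [s_k = a_k + i b_k],
    [log (1 / |g (sig + i t)|) >= sum m_k log |(s + conj s_k) / (s - s_k)|
      >= sum m_k 2 sig a_k / ((sig + a_k)^2 + (t - b_k)^2)].
    For large [sig] the left side is uniformly close to [log (1 / |g (+oo)|)],
    since a Dirichlet series tends to its first coefficient uniformly in [t].
    Integrate over [|t| < (1 + e) T]: each term contributes almost
    [2 PI sig a_k / (sig + a_k)], and the [a_k] are bounded, so that letting [T],
    then [sig], tend to infinity gives the theorem.

    Boundedness after division is Schwarz's lemma: the half-plane is mapped to
    the disc, and the value at the centre is bounded by the maximum on circles
    of radius close to 1.  This needs only Goursat's lemma, in the coordinate
    [log z]. *)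

(** * Continuity and complex differentiability at a point *)

Definition ccont (F : C -> C) (z : C) : Prop :=
  forall eps : R, 0 < eps -> exists d : R, 0 < d /\
    forall w : C, Cmod (w - z)%C < d -> Cmod (F w - F z)%C < eps.

(* Caratheodory's form of complex differentiability: the difference quotient,
   completed by the derivative at [z], is continuous at [z]. *)
Definition cdiff (F : C -> C) (z : C) : Prop :=
  exists phi : C -> C, ccont phi z /\
    forall w : C, (F w - F z)%C = (phi w * (w - z))%C.

Definition cnear (z : C) (P : C -> Prop) : Prop :=
  exists d : R, 0 < d /\ forall w : C, Cmod (w - z)%C < d -> P w.

Lemma Cmod_sub_self (z : C) : Cmod (z - z)%C = 0.
Proof. replace (z - z)%C with (RtoC 0) by ring. apply Cmod_0. Qed.

Lemma Cmod_sub_comm (z w : C) : Cmod (z - w)%C = Cmod (w - z)%C.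
Proof. rewrite <- (Cmod_opp (w - z)%C). f_equal. ring. Qed.

Lemma Cmod_sub_triangle (x y : C) : Cmod x - Cmod y <= Cmod (x - y)%C.
Proof.
  pose proof (Cmod_triangle (x - y)%C y) as H.
  replace (x - y + y)%C with x in H by ring. lra.
Qed.

Lemma cnear_self (z : C) (P : C -> Prop) : cnear z P -> P z.
Proof. intros [d [Hd H]]. apply H. now rewrite Cmod_sub_self. Qed.

Lemma cnear_and (z : C) (P Q : C -> Prop) :
  cnear z P -> cnear z Q -> cnear z (fun w => P w /\ Q w).
Proof.
  intros [d1 [Hd1 H1]] [d2 [Hd2 H2]]. exists (Rmin d1 d2). split.
  - now apply Rmin_pos.
  - intros w Hw. split.
    + apply H1. eapply Rlt_le_trans; [exact Hw | apply Rmin_l].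
    + apply H2. eapply Rlt_le_trans; [exact Hw | apply Rmin_r].
Qed.

Lemma cnear_imp (z : C) (P Q : C -> Prop) :
  (forall w, P w -> Q w) -> cnear z P -> cnear z Q.
Proof. intros H [d [Hd H1]]. exists d. auto. Qed.

Lemma cnear_neq (z s : C) : z <> s -> cnear z (fun w => w <> s).
Proof.
  intros H. exists (Cmod (s - z)%C). split.
  - apply Cmod_gt_0, Cminus_eq_contra. congruence.
  - intros w Hw ->. lra.
Qed.

Lemma ccont_near (F : C -> C) (z : C) (eps : R) : ccont F z -> 0 < eps ->
  cnear z (fun w => Cmod (F w - F z)%C < eps).
Proof. intros H He. exact (H eps He). Qed.

Lemma ccont_const (c z : C) : ccont (fun _ => c) z.
Proof. intros e He. exists 1. split; [lra|]. intros w _. now rewrite Cmod_sub_self. Qed.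

Lemma ccont_id (z : C) : ccont (fun w => w) z.
Proof. intros e He. exists e. auto. Qed.

Lemma ccont_ext_near (F G : C -> C) (z : C) :
  cnear z (fun w => F w = G w) -> ccont F z -> ccont G z.
Proof.
  intros E HF e He.
  pose proof (cnear_self _ _ E) as E0. simpl in E0.
  destruct (cnear_and _ _ _ E (ccont_near _ _ _ HF He)) as [d [Hd H]].
  exists d. split; [exact Hd|]. intros w Hw. destruct (H w Hw) as [E1 H1].
  now rewrite <- E1, <- E0.
Qed.

Lemma ccont_plus (F G : C -> C) (z : C) :
  ccont F z -> ccont G z -> ccont (fun w => F w + G w)%C z.
Proof.
  intros HF HG e He.
  destruct (cnear_and _ _ _ (ccont_near _ _ (e / 2) HF ltac:(lra))
    (ccont_near _ _ (e / 2) HG ltac:(lra))) as [d [Hd H]].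
  exists d. split; [exact Hd|]. intros w Hw. destruct (H w Hw) as [H1 H2].
  replace (F w + G w - (F z + G z))%C with ((F w - F z) + (G w - G z))%C by ring.
  eapply Rle_lt_trans; [apply Cmod_triangle|]. lra.
Qed.

Lemma ccont_mult (F G : C -> C) (z : C) :
  ccont F z -> ccont G z -> ccont (fun w => F w * G w)%C z.
Proof.
  intros HF HG e He.
  set (k := 1 + Cmod (F z) + Cmod (G z)).
  assert (Hk : 1 <= k).
  { unfold k. pose proof (Cmod_ge_0 (F z)). pose proof (Cmod_ge_0 (G z)). lra. }
  (* Bounding the product of the two increments by [e1] (as [e1 <= 1]), the total error is below
     [e1 * (1 + |F z| + |G z|) = e1 * k <= e]. *)
  set (e1 := Rmin 1 (e / k)).
  assert (He1 : 0 < e1).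
  { apply Rmin_pos; [lra|]. apply Rdiv_lt_0_compat; lra. }
  destruct (cnear_and _ _ _ (ccont_near _ _ e1 HF He1)
    (ccont_near _ _ e1 HG He1)) as [d [Hd H]].
  exists d. split; [exact Hd|]. intros w Hw. destruct (H w Hw) as [H1 H2].
  replace (F w * G w - F z * G z)%C with
    ((F w - F z) * (G w - G z) + (F z * (G w - G z) + G z * (F w - F z)))%C by ring.
  eapply Rle_lt_trans; [apply Cmod_triangle|].
  eapply Rle_lt_trans; [apply Rplus_le_compat_l, Cmod_triangle|].
  rewrite !Cmod_mult.
  assert (Hee : e1 * k <= e).
  { apply Rle_trans with (e / k * k).
    - apply Rmult_le_compat_r; [lra | apply Rmin_r].
    - right. field. lra. }
  assert (H11 : e1 <= 1) by apply Rmin_l.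
  pose proof (Cmod_ge_0 (F w - F z)%C). pose proof (Cmod_ge_0 (G w - G z)%C).
  pose proof (Cmod_ge_0 (F z)). pose proof (Cmod_ge_0 (G z)).
  assert (Cmod (F w - F z)%C * Cmod (G w - G z)%C < e1).
  { apply Rle_lt_trans with (Cmod (F w - F z)%C * 1); [|lra].
    apply Rmult_le_compat_l; lra. }
  assert (Cmod (F z) * Cmod (G w - G z)%C <= Cmod (F z) * e1)
    by (apply Rmult_le_compat_l; lra).
  assert (Cmod (G z) * Cmod (F w - F z)%C <= Cmod (G z) * e1)
    by (apply Rmult_le_compat_l; lra).
  unfold k in Hee. lra.
Qed.

Lemma ccont_inv (F : C -> C) (z : C) :
  ccont F z -> F z <> RtoC 0 -> ccont (fun w => / F w)%C z.
Proof.
  intros HF H0 e He.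
  pose proof (proj1 (Cmod_gt_0 _) H0) as Hm. set (m := Cmod (F z)) in *.
  assert (Hem : 0 < e * m * m) by (repeat apply Rmult_lt_0_compat; lra).
  (* The bound [m / 2] keeps [|F w| > m / 2]; the other one then absorbs the denominator
     [|F w| * m > m * m / 2]. *)
  assert (Hd1 : 0 < Rmin (m / 2) (e * m * m / 2)) by (apply Rmin_pos; lra).
  destruct (ccont_near _ _ _ HF Hd1) as [d [Hd H]].
  exists d. split; [exact Hd|]. intros w Hw. specialize (H w Hw).
  assert (Ha : Cmod (F w - F z)%C < m / 2) by (eapply Rlt_le_trans; [exact H | apply Rmin_l]).
  assert (Hb : Cmod (F w - F z)%C < e * m * m / 2)
    by (eapply Rlt_le_trans; [exact H | apply Rmin_r]).
  assert (Hw2 : m / 2 < Cmod (F w)).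
  { pose proof (Cmod_sub_triangle (F z) (F w)) as T. rewrite Cmod_sub_comm in T.
    fold m in T. lra. }
  assert (Hw0 : F w <> RtoC 0) by (apply Cmod_gt_0; lra).
  replace (/ F w - / F z)%C with (- ((F w - F z) / (F w * F z)))%C by (field; auto).
  rewrite Cmod_opp, Cmod_div, Cmod_mult by now apply Cmult_neq_0.
  fold m. apply Rlt_div_l; [apply Rmult_lt_0_compat; lra|].
  assert (e * m * (m / 2) <= e * m * Cmod (F w)) by (apply Rmult_le_compat_l; nra).
  nra.
Qed.

Lemma ccont_comp (F G : C -> C) (z : C) :
  ccont G z -> ccont F (G z) -> ccont (fun w => F (G w)) z.
Proof.
  intros HG HF e He. destruct (HF e He) as [d1 [Hd1 H1]].
  destruct (HG d1 Hd1) as [d [Hd H]]. exists d. auto.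
Qed.

Lemma cdiff_ccont (F : C -> C) (z : C) : cdiff F z -> ccont F z.
Proof.
  intros [phi [Hp E]].
  apply ccont_ext_near with (fun w => F z + phi w * (w + - z))%C.
  - exists 1. split; [lra|]. intros w _.
    replace (w + - z)%C with (w - z)%C by ring. rewrite <- E. ring.
  - apply ccont_plus; [apply ccont_const|]. apply ccont_mult; [exact Hp|].
    apply ccont_plus; [apply ccont_id | apply ccont_const].
Qed.

Lemma cdiff_of_linear_approx (F : C -> C) (z l : C) :
  (forall eps : R, 0 < eps ->
     cnear z (fun w => Cmod (F w - F z - l * (w - z))%C <= eps * Cmod (w - z)%C)) ->
  cdiff F z.
Proof.
  intros H.
  exists (fun w => if Ceq_dec w z then l else ((F w - F z) / (w - z))%C). split.
  - intros e He. destruct (H (e / 2) ltac:(lra)) as [d [Hd H1]].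
    exists d. split; [exact Hd|]. intros w Hw.
    destruct (Ceq_dec z z) as [_|n]; [|now elim n].
    destruct (Ceq_dec w z) as [->|n]; [now rewrite Cmod_sub_self|].
    pose proof (Cminus_eq_contra _ _ n) as n'.
    pose proof (proj1 (Cmod_gt_0 _) n') as Hm.
    replace ((F w - F z) / (w - z) - l)%C
      with ((F w - F z - l * (w - z)) / (w - z))%C by (field; exact n').
    rewrite Cmod_div by exact n'. apply Rlt_div_l; [exact Hm|].
    specialize (H1 w Hw). nra.
  - intros w. destruct (Ceq_dec w z) as [->|n]; [ring|].
    field. now apply Cminus_eq_contra.
Qed.

Lemma cdiff_linear_approx (F : C -> C) (z : C) : cdiff F z ->
  exists l : C, forall eps : R, 0 < eps ->
    cnear z (fun w => Cmod (F w - F z - l * (w - z))%C <= eps * Cmod (w - z)%C).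
Proof.
  intros [phi [Hp E]]. exists (phi z). intros e He.
  destruct (Hp e He) as [d [Hd H]]. exists d. split; [exact Hd|]. intros w Hw.
  rewrite E. replace (phi w * (w - z) - phi z * (w - z))%C
    with ((phi w - phi z) * (w - z))%C by ring.
  rewrite Cmod_mult. apply Rmult_le_compat_r; [apply Cmod_ge_0|]. left. now apply H.
Qed.

Lemma cdiff_ext_near (F G : C -> C) (z : C) :
  cnear z (fun w => F w = G w) -> cdiff F z -> cdiff G z.
Proof.
  intros E HF. destruct (cdiff_linear_approx _ _ HF) as [l Hl].
  apply cdiff_of_linear_approx with l. intros e He.
  pose proof (cnear_self _ _ E) as E0. simpl in E0.
  apply cnear_imp with (2 := cnear_and _ _ _ E (Hl e He)).
  intros w [E1 H1]. now rewrite <- E1, <- E0.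
Qed.

Lemma cdiff_const (c z : C) : cdiff (fun _ => c) z.
Proof. exists (fun _ => RtoC 0). split; [apply ccont_const|]. intros w. ring. Qed.

Lemma cdiff_id (z : C) : cdiff (fun w => w) z.
Proof. exists (fun _ => RtoC 1). split; [apply ccont_const|]. intros w. ring. Qed.

Lemma cdiff_plus (F G : C -> C) (z : C) :
  cdiff F z -> cdiff G z -> cdiff (fun w => F w + G w)%C z.
Proof.
  intros [p [Hp Ep]] [q [Hq Eq]]. exists (fun w => p w + q w)%C. split.
  - now apply ccont_plus.
  - intros w. rewrite Cmult_plus_distr_r, <- Ep, <- Eq. ring.
Qed.

Lemma cdiff_mult (F G : C -> C) (z : C) :
  cdiff F z -> cdiff G z -> cdiff (fun w => F w * G w)%C z.
Proof.
  intros HF HG. pose proof (cdiff_ccont _ _ HF) as CF.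
  destruct HF as [p [Hp Ep]]. destruct HG as [q [Hq Eq]].
  exists (fun w => p w * G z + F w * q w)%C. split.
  - apply ccont_plus; apply ccont_mult; auto. apply ccont_const.
  - intros w.
    replace ((p w * G z + F w * q w) * (w - z))%C
      with ((p w * (w - z)) * G z + F w * (q w * (w - z)))%C by ring.
    rewrite <- Ep, <- Eq. ring.
Qed.

Lemma cdiff_inv (F : C -> C) (z : C) :
  cdiff F z -> F z <> RtoC 0 -> cdiff (fun w => / F w)%C z.
Proof.
  intros HF H0. pose proof (cdiff_ccont _ _ HF) as CF.
  assert (N : cnear z (fun w => F w <> RtoC 0)).
  { apply cnear_imp with (2 := ccont_near _ _ _ CF (proj1 (Cmod_gt_0 _) H0)).
    intros w Hw E. rewrite E in Hw.
    replace (0 - F z)%C with (- F z)%C in Hw by ring. rewrite Cmod_opp in Hw. lra. }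
  (* [/ 0] is not controlled, so [F] is first replaced by a nonvanishing function. *)
  set (F' := fun w => if Ceq_dec (F w) 0 then F z else F w).
  assert (NF' : forall w, F' w <> RtoC 0).
  { intros w. unfold F'. now destruct (Ceq_dec (F w) 0). }
  assert (E' : cnear z (fun w => F w = F' w)).
  { apply cnear_imp with (2 := N). intros w Hw. unfold F'.
    now destruct (Ceq_dec (F w) 0). }
  apply cdiff_ext_near with (fun w => / F' w)%C.
  { apply cnear_imp with (2 := E'). intros w Hw. now rewrite Hw. }
  pose proof (cdiff_ext_near _ _ _ E' HF) as HF'.
  pose proof (cdiff_ccont _ _ HF') as CF'.
  destruct HF' as [p [Hp Ep]].
  exists (fun w => (- / F' z) * (p w * / F' w))%C. split.
  - apply ccont_mult; [apply ccont_const|]. apply ccont_mult; [exact Hp|].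
    now apply ccont_inv.
  - intros w. replace (- / F' z * (p w * / F' w) * (w - z))%C
      with (- / F' z * / F' w * (p w * (w - z)))%C by ring.
    rewrite <- Ep. field. split; apply NF'.
Qed.

Lemma cdiff_comp (F G : C -> C) (z : C) :
  cdiff G z -> cdiff F (G z) -> cdiff (fun w => F (G w)) z.
Proof.
  intros HG HF. pose proof (cdiff_ccont _ _ HG) as CG.
  destruct HF as [p [Hp Ep]]. destruct HG as [q [Hq Eq]].
  exists (fun w => p (G w) * q w)%C. split.
  - apply ccont_mult; [|exact Hq]. now apply ccont_comp.
  - intros w. rewrite Ep, Eq. ring.
Qed.

Lemma cdiff_pow (F : C -> C) (n : nat) (z : C) :
  cdiff F z -> cdiff (fun w => Cpow (F w) n) z.
Proof.
  intros HF. induction n as [|n IH]; [exact (cdiff_const (RtoC 1) z)|].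
  exact (cdiff_mult _ _ _ HF IH).
Qed.

Lemma C_differentiable_cdiff (F : C -> C) (z : C) : C_differentiable F z -> cdiff F z.
Proof.
  intros [l [_ H]].
  specialize (H z (fun P HP => HP)).
  apply cdiff_of_linear_approx with l. intros e He.
  destruct (H (mkposreal e He)) as [d Hd].
  exists d. split; [apply cond_pos|]. intros w Hw.
  specialize (Hd w Hw). change (Cmod (F w - F z - (w - z) * l)%C <= e * Cmod (w - z)%C) in Hd.
  now rewrite (Cmult_comm l).
Qed.

Lemma locally_cnear (z : C) (P : C -> Prop) : @locally C_UniformSpace z P -> cnear z P.
Proof.
  intros H. apply locally_C in H. destruct H as [d Hd].
  exists d. split; [apply cond_pos|]. intros w Hw. apply Hd. exact Hw.
Qed.

(** * The complex exponential *)

Lemma Cmod_pair_le (x y : R) : Cmod (x, y) <= Rabs x + Rabs y.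
Proof.
  replace ((x, y) : C) with (RtoC x + RtoC y * Ci)%C
    by (unfold RtoC, Ci, Cplus, Cmult; simpl; f_equal; ring).
  eapply Rle_trans; [apply Cmod_triangle|].
  rewrite Cmod_mult, !Cmod_R, Cmod_Ci. lra.
Qed.

Lemma Rabs_Im_le_Cmod (z : C) : Rabs (Im z) <= Cmod z.
Proof. eapply Rle_trans; [apply Rmax_r | apply Rmax_Cmod]. Qed.

Lemma is_derive_linear_approx (h : R -> R) (x l eps : R) : is_derive h x l -> 0 < eps ->
  exists d, 0 < d /\ forall y, Rabs (y - x) < d ->
    Rabs (h y - h x - l * (y - x)) <= eps * Rabs (y - x).
Proof.
  intros [_ H] He. specialize (H x (fun P HP => HP) (mkposreal eps He)).
  destruct H as [d Hd]. exists d. split; [apply cond_pos|]. intros y Hy.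
  specialize (Hd y Hy).
  change (Rabs (h y - h x - (y - x) * l) <= eps * Rabs (y - x)) in Hd.
  now rewrite (Rmult_comm l).
Qed.

Lemma Cexp'_plus (z w : C) : Cexp' (z + w)%C = (Cexp' z * Cexp' w)%C.
Proof.
  unfold Cexp'. rewrite re_plus, im_plus, exp_plus, cos_plus, sin_plus.
  unfold Cmult; simpl. f_equal; ring.
Qed.

Lemma Cmod_Cexp' (z : C) : Cmod (Cexp' z) = exp (Re z).
Proof.
  unfold Cexp', Cmod; simpl fst; simpl snd.
  replace ((exp (Re z) * cos (Im z)) ^ 2 + (exp (Re z) * sin (Im z)) ^ 2)
    with (exp (Re z) ^ 2).
  - apply sqrt_pow2. left. apply exp_pos.
  - pose proof (sin2_cos2 (Im z)) as H. unfold Rsqr in H.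
    transitivity (exp (Re z) ^ 2 * (sin (Im z) * sin (Im z) + cos (Im z) * cos (Im z)));
      [rewrite H; ring | ring].
Qed.

(** The real expansions [exp a = 1 + a + X], [cos b = 1 + Y], [sin b = b + Z], with remainders at
    most [e1] times the modulus [m] of [(a, b)], are multiplied out. *)
Lemma cdiff_Cexp'_0 : cdiff Cexp' 0.
Proof.
  apply cdiff_of_linear_approx with (RtoC 1). intros e He.
  (* The four error terms are at most [e1 m], [3 e1 m], [4 m^2] and [e1 m]. Since [m < e1], they add
     up to at most [9 e1 m], which [e / 10] covers. *)
  set (e1 := Rmin 1 (e / 10)).
  assert (He1 : 0 < e1) by (apply Rmin_pos; lra).
  assert (He11 : e1 <= 1) by apply Rmin_l.
  assert (He12 : e1 <= e / 10) by apply Rmin_r.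
  assert (Dexp : is_derive exp 0 1) by (auto_derive; [easy | rewrite exp_0; ring]).
  assert (Dcos : is_derive cos 0 0) by (auto_derive; [easy | rewrite sin_0; ring]).
  assert (Dsin : is_derive sin 0 1) by (auto_derive; [easy | rewrite cos_0; ring]).
  destruct (is_derive_linear_approx _ _ _ e1 Dexp He1) as [d1 [Hd1 H1]].
  destruct (is_derive_linear_approx _ _ _ e1 Dcos He1) as [d2 [Hd2 H2]].
  destruct (is_derive_linear_approx _ _ _ e1 Dsin He1) as [d3 [Hd3 H3]].
  exists (Rmin e1 (Rmin d1 (Rmin d2 d3))).
  split; [repeat apply Rmin_pos; lra|].
  intros [a b] Hw.
  replace ((a, b) - 0)%C with ((a, b) : C) in *
    by (unfold Cminus, Cplus, Copp, RtoC; simpl; f_equal; ring).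
  pose proof (re_le_Cmod (a, b)) as Ha. pose proof (Rabs_Im_le_Cmod (a, b)) as Hb.
  simpl in Ha, Hb.
  set (m := Cmod (a, b)) in *.
  assert (Hm1 : m < e1) by (eapply Rlt_le_trans; [exact Hw | apply Rmin_l]).
  assert (Hm2 : m < Rmin d1 (Rmin d2 d3)) by (eapply Rlt_le_trans; [exact Hw | apply Rmin_r]).
  assert (Hmd1 : m < d1) by (eapply Rlt_le_trans; [exact Hm2 | apply Rmin_l]).
  assert (Hm3 : m < Rmin d2 d3) by (eapply Rlt_le_trans; [exact Hm2 | apply Rmin_r]).
  assert (Hmd2 : m < d2) by (eapply Rlt_le_trans; [exact Hm3 | apply Rmin_l]).
  assert (Hmd3 : m < d3) by (eapply Rlt_le_trans; [exact Hm3 | apply Rmin_r]).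
  specialize (H1 a). specialize (H2 b). specialize (H3 b).
  rewrite exp_0 in H1. rewrite cos_0 in H2. rewrite sin_0 in H3.
  rewrite (Rminus_0_r a) in H1. rewrite (Rminus_0_r b) in H2, H3.
  specialize (H1 ltac:(lra)). specialize (H2 ltac:(lra)). specialize (H3 ltac:(lra)).
  assert (Hm0 : 0 <= m) by apply Cmod_ge_0.
  assert (e1 * Rabs a <= e1 * m) by (apply Rmult_le_compat_l; lra).
  assert (e1 * Rabs b <= e1 * m) by (apply Rmult_le_compat_l; lra).
  set (X := exp a - 1 - 1 * a) in *. set (Y := cos b - 1 - 0 * b) in *.
  set (Z := sin b - 0 - 1 * b) in *.
  replace (Cexp' (a, b) - Cexp' 0 - 1 * (a, b))%C
    with ((X + (1 + a + X) * Y, (a + X) * sin b + Z) : C).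
  2:{ unfold X, Y, Z, Cexp', Cminus, Cplus, Cmult, Copp, RtoC, Re, Im; simpl.
      rewrite exp_0, cos_0, sin_0. f_equal; ring. }
  eapply Rle_trans; [apply Cmod_pair_le|].
  assert (Hee : e1 * m <= 1 * m) by (apply Rmult_le_compat_r; lra).
  assert (HX1 : Rabs (1 + a + X) <= 3).
  { eapply Rle_trans; [apply Rabs_triang|].
    pose proof (Rabs_triang 1 a). rewrite Rabs_R1 in *. lra. }
  assert (HaX : Rabs (a + X) <= 2 * m).
  { eapply Rle_trans; [apply Rabs_triang|]. lra. }
  assert (HZ : Rabs (sin b) <= 2 * m).
  { replace (sin b) with (Z + b) by (unfold Z; ring).
    eapply Rle_trans; [apply Rabs_triang|]. lra. }
  pose proof (Rabs_triang X ((1 + a + X) * Y)) as T1.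
  pose proof (Rabs_triang ((a + X) * sin b) Z) as T2.
  rewrite Rabs_mult in T1, T2.
  assert (Rabs (1 + a + X) * Rabs Y <= 3 * (e1 * m)).
  { apply Rmult_le_compat; try apply Rabs_pos; lra. }
  assert (Rabs (a + X) * Rabs (sin b) <= (2 * m) * (2 * m)).
  { apply Rmult_le_compat; try apply Rabs_pos; lra. }
  assert (m * m <= e1 * m) by (apply Rmult_le_compat_r; lra).
  assert (e1 * m <= e / 10 * m) by (apply Rmult_le_compat_r; lra).
  assert (0 <= e * m) by (apply Rmult_le_pos; lra). lra.
Qed.

(** The functional equation moves the question to the origin. *)
Lemma cdiff_Cexp' (z : C) : cdiff Cexp' z.
Proof.
  apply cdiff_ext_near with (fun w => Cexp' z * Cexp' (w + - z))%C.
  - exists 1. split; [lra|]. intros w _. rewrite <- Cexp'_plus. f_equal. ring.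
  - apply cdiff_mult; [apply cdiff_const|].
    apply (cdiff_comp Cexp' (fun w => w + - z)%C).
    + apply cdiff_plus; [apply cdiff_id | apply cdiff_const].
    + replace (z + - z)%C with (RtoC 0) by ring. apply cdiff_Cexp'_0.
Qed.

(** * Goursat's lemma on rectangles *)

Lemma nested_common_point (u w : nat -> R) :
  (forall n, u n <= u (S n)) -> (forall n, w (S n) <= w n) -> (forall n, u n <= w n) ->
  exists p, forall n, u n <= p <= w n.
Proof.
  intros Hu Hw Huw.
  assert (Mu : forall n k, u n <= u (n + k)%nat).
  { intros n k. induction k as [|k IH]; [rewrite Nat.add_0_r; lra|].
    rewrite Nat.add_succ_r. specialize (Hu (n + k)%nat). lra. }
  assert (Mw : forall n k, w (n + k)%nat <= w n).
  { intros n k. induction k as [|k IH]; [rewrite Nat.add_0_r; lra|].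
    rewrite Nat.add_succ_r. specialize (Hw (n + k)%nat). lra. }
  assert (X : forall n m, u n <= w m).
  { intros n m. specialize (Mu n m). specialize (Mw m n). specialize (Huw (n + m)%nat).
    rewrite Nat.add_comm in Mw. lra. }
  destruct (completeness (fun r => exists n, r = u n)) as [p [Hp1 Hp2]].
  - exists (w O). intros r [n ->]. apply X.
  - exists (u O). now exists O.
  - exists p. intros n. split.
    + apply Hp1. now exists n.
    + apply Hp2. intros r [m ->]. apply X.
Qed.

Section Bisection.

Variables (A B x0 y0 t0 : R) (Q : R -> R -> R -> Prop).
Hypotheses (hA : 0 < A) (hB : 0 < B) (ht0 : 0 < t0).

(** A rectangle is encoded by its lower left corner and one scale [t], so that every rectangle met
    in the bisection is similar to the initial one. *)
Definition subrect (x y t : R) : Prop :=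
  x0 <= x /\ x + A * t <= x0 + A * t0 /\ y0 <= y /\ y + B * t <= y0 + B * t0.

Hypothesis Qsplit : forall x y s, 0 < s -> subrect x y (s + s) ->
  Q x y s -> Q (x + A * s) y s -> Q x (y + B * s) s -> Q (x + A * s) (y + B * s) s ->
  Q x y (s + s).
Hypothesis Qlocal : forall p q, x0 <= p <= x0 + A * t0 -> y0 <= q <= y0 + B * t0 ->
  exists d, 0 < d /\ forall x y t, 0 < t < d -> subrect x y t ->
    x <= p <= x + A * t -> y <= q <= y + B * t -> Q x y t.

(** Moves to a quarter on which [Q] fails. The fourth quarter is taken untested: if [Q] fails on the
    parent and holds on the other three, it must fail there by [Qsplit]. *)
Let step (p : R * R) (s : R) : R * R :=
  let (x, y) := p in
  if excluded_middle_informative (Q x y s) then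
    if excluded_middle_informative (Q (x + A * s) y s) then
      if excluded_middle_informative (Q x (y + B * s) s) then (x + A * s, y + B * s)
      else (x, y + B * s)
    else (x + A * s, y)
  else (x, y).

Let side (n : nat) : R := t0 * (/ 2) ^ n.

Fixpoint bad (n : nat) : R * R :=
  match n with
  | O => (x0, y0)
  | S k => step (bad k) (side (S k))
  end.

Lemma side_S (n : nat) : side n = side (S n) + side (S n).
Proof. unfold side. simpl. field. Qed.

Lemma side_pos (n : nat) : 0 < side n.
Proof. apply Rmult_lt_0_compat; [exact ht0|]. apply pow_lt. lra. Qed.

Lemma bad_step (n : nat) :
  fst (bad n) <= fst (bad (S n)) /\
  fst (bad (S n)) + A * side (S n) <= fst (bad n) + A * side n /\
  snd (bad n) <= snd (bad (S n)) /\
  snd (bad (S n)) + B * side (S n) <= snd (bad n) + B * side n.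
Proof.
  pose proof (side_pos (S n)) as Hs. rewrite (side_S n).
  assert (0 < A * side (S n)) by now apply Rmult_lt_0_compat.
  assert (0 < B * side (S n)) by now apply Rmult_lt_0_compat.
  simpl bad. destruct (bad n) as [x y]. unfold step.
  repeat destruct excluded_middle_informative; simpl fst; simpl snd; lra.
Qed.

Lemma bad_subrect (n : nat) : subrect (fst (bad n)) (snd (bad n)) (side n).
Proof.
  induction n as [|n IH].
  - unfold side, subrect; simpl. lra.
  - pose proof (bad_step n). unfold subrect in *. lra.
Qed.

Lemma bad_not_Q (n : nat) : ~ Q x0 y0 t0 -> ~ Q (fst (bad n)) (snd (bad n)) (side n).
Proof.
  intros N. induction n as [|n IH].
  - unfold side; simpl. now rewrite Rmult_1_r.
  - pose proof (bad_subrect n) as Hsub. pose proof (side_pos (S n)) as Hs.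
    rewrite (side_S n) in IH, Hsub. simpl bad. destruct (bad n) as [x y].
    simpl fst in *; simpl snd in *. unfold step.
    repeat destruct excluded_middle_informative; simpl; auto.
Qed.

(** If [Q] failed initially, it would fail along nested rectangles shrinking to a common point
    [(p, q)], whereas [Qlocal] gives [Q] on all small rectangles around that point. *)
Lemma bisection : Q x0 y0 t0.
Proof.
  apply NNPP. intros N.
  destruct (nested_common_point (fun n => fst (bad n)) (fun n => fst (bad n) + A * side n))
    as [p Hp].
  { intros n. apply bad_step. } { intros n. apply bad_step. }
  { intros n. pose proof (side_pos n). nra. }
  destruct (nested_common_point (fun n => snd (bad n)) (fun n => snd (bad n) + B * side n))
    as [q Hq].
  { intros n. apply bad_step. } { intros n. apply bad_step. }
  { intros n. pose proof (side_pos n). nra. }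
  destruct (Qlocal p q) as [d [Hd H]].
  { specialize (Hp O). unfold side in Hp; simpl in Hp. lra. }
  { specialize (Hq O). unfold side in Hq; simpl in Hq. lra. }
  destruct (pow_lt_1_zero (/ 2) ltac:(rewrite Rabs_pos_eq; lra) (d / t0)) as [n Hn].
  { now apply Rdiv_lt_0_compat. }
  specialize (Hn n (Nat.le_refl n)).
  rewrite Rabs_pos_eq in Hn by (left; apply pow_lt; lra).
  apply (bad_not_Q n N). apply H; auto using bad_subrect.
  split; [apply side_pos|]. unfold side.
  apply Rlt_div_r in Hn; [|exact ht0]. lra.
Qed.

End Bisection.

(* The real part of the integral of [F] along the boundary of the rectangle
   with lower left corner (x, y) and sides [A t], [B t]. *)
Definition rect_int (F : C -> C) (A B x y t : R) : R :=
  RInt (fun u => Re (F (u, y)) - Re (F (u, y + B * t))) x (x + A * t) -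
  RInt (fun v => Im (F (x + A * t, v)) - Im (F (x, v))) y (y + B * t).

Lemma continuous_Re_horizontal (F : C -> C) (u v : R) :
  ccont F (u, v) -> continuous (fun x => Re (F (x, v))) u.
Proof.
  intros H. apply filterlim_locally. intros e.
  destruct (H e (cond_pos e)) as [d [Hd H1]]. exists (mkposreal d Hd). intros x Hx.
  change (Rabs (x - u) < d) in Hx.
  change (Rabs (Re (F (x, v)) - Re (F (u, v))) < e).
  eapply Rle_lt_trans; [apply (re_le_Cmod (F (x, v) - F (u, v))%C)|].
  apply H1. replace ((x, v) - (u, v))%C with (RtoC (x - u))
    by (unfold Cminus, Cplus, Copp, RtoC; simpl; f_equal; ring).
  now rewrite Cmod_R.
Qed.

Lemma continuous_Im_vertical (F : C -> C) (u v : R) :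
  ccont F (u, v) -> continuous (fun y => Im (F (u, y))) v.
Proof.
  intros H. apply filterlim_locally. intros e.
  destruct (H e (cond_pos e)) as [d [Hd H1]]. exists (mkposreal d Hd). intros y Hy.
  change (Rabs (y - v) < d) in Hy.
  change (Rabs (Im (F (u, y)) - Im (F (u, v))) < e).
  eapply Rle_lt_trans; [apply (Rabs_Im_le_Cmod (F (u, y) - F (u, v))%C)|].
  apply H1. replace ((u, y) - (u, v))%C with (RtoC (y - v) * Ci)%C
    by (unfold Cminus, Cplus, Copp, Cmult, Ci, RtoC; simpl; f_equal; ring).
  rewrite Cmod_mult, Cmod_Ci, Cmod_R. lra.
Qed.

Lemma RInt_const_approx (h : R -> R) (a b c e : R) : a <= b -> ex_RInt h a b ->
  (forall x, a <= x <= b -> Rabs (h x - c) <= e) ->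
  Rabs (RInt h a b - c * (b - a)) <= e * (b - a).
Proof.
  intros Hab Hh H.
  assert (U : RInt h a b <= RInt (fun _ => c + e) a b).
  { apply RInt_le; auto; [apply ex_RInt_const|]. intros x Hx.
    specialize (H x ltac:(lra)). apply Rabs_le_between in H. lra. }
  assert (L : RInt (fun _ => c - e) a b <= RInt h a b).
  { apply RInt_le; auto; [apply ex_RInt_const|]. intros x Hx.
    specialize (H x ltac:(lra)). apply Rabs_le_between in H. lra. }
  rewrite RInt_const in U, L. unfold scal in U, L; simpl in U, L.
  unfold mult in U, L; simpl in U, L.
  apply Rabs_le. lra.
Qed.

Section Goursat.

Variables (F : C -> C) (A B x0 y0 : R).
Hypotheses (hA : 0 < A) (hB : 0 < B).
Hypothesis hF : forall u v, x0 <= u <= x0 + A -> y0 <= v <= y0 + B -> cdiff F (u, v).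

Lemma ex_RInt_Re_horizontal (a b v : R) :
  x0 <= a <= b -> b <= x0 + A -> y0 <= v <= y0 + B -> ex_RInt (fun u => Re (F (u, v))) a b.
Proof.
  intros Ha Hb Hv. apply (ex_RInt_continuous (V := R_CompleteNormedModule)).
  rewrite Rmin_left, Rmax_right by lra. intros u Hu.
  apply continuous_Re_horizontal, cdiff_ccont, hF; lra.
Qed.

Lemma ex_RInt_Im_vertical (a b u : R) :
  y0 <= a <= b -> b <= y0 + B -> x0 <= u <= x0 + A -> ex_RInt (fun v => Im (F (u, v))) a b.
Proof.
  intros Ha Hb Hv. apply (ex_RInt_continuous (V := R_CompleteNormedModule)).
  rewrite Rmin_left, Rmax_right by lra. intros v Hu.
  apply continuous_Im_vertical, cdiff_ccont, hF; lra.
Qed.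

Lemma rect_int_eq (x y t : R) : 0 <= t -> subrect A B x0 y0 1 x y t ->
  rect_int F A B x y t =
  RInt (fun u => Re (F (u, y))) x (x + A * t)
  - RInt (fun u => Re (F (u, y + B * t))) x (x + A * t)
  - RInt (fun v => Im (F (x + A * t, v))) y (y + B * t)
  + RInt (fun v => Im (F (x, v))) y (y + B * t).
Proof.
  intros Ht [H1 [H2 [H3 H4]]].
  assert (0 <= A * t) by (apply Rmult_le_pos; lra).
  assert (0 <= B * t) by (apply Rmult_le_pos; lra).
  unfold rect_int.
  rewrite (RInt_minus (V := R_CompleteNormedModule)
    (fun u => Re (F (u, y))) (fun u => Re (F (u, y + B * t))))
    by (apply ex_RInt_Re_horizontal; lra).
  rewrite (RInt_minus (V := R_CompleteNormedModule)
    (fun v => Im (F (x + A * t, v))) (fun v => Im (F (x, v))))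
    by (apply ex_RInt_Im_vertical; lra).
  unfold minus, plus, opp; simpl. ring.
Qed.

(** Each inner side is traversed twice, in opposite directions, and cancels. *)
Lemma rect_int_split (x y s : R) : 0 < s -> subrect A B x0 y0 1 x y (s + s) ->
  rect_int F A B x y (s + s) =
  rect_int F A B x y s + rect_int F A B (x + A * s) y s +
  rect_int F A B x (y + B * s) s + rect_int F A B (x + A * s) (y + B * s) s.
Proof.
  intros Hs Hsub. assert (H0 := Hsub). destruct H0 as [H1 [H2 [H3 H4]]].
  rewrite Rmult_plus_distr_l in H2, H4.
  assert (0 < A * s) by now apply Rmult_lt_0_compat.
  assert (0 < B * s) by now apply Rmult_lt_0_compat.
  rewrite !rect_int_eq; unfold subrect; try rewrite !Rmult_plus_distr_l; try lra.
  rewrite <- !Rplus_assoc.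
  assert (Ch : forall v, y0 <= v <= y0 + B ->
    RInt (fun u => Re (F (u, v))) x (x + A * s + A * s) =
    RInt (fun u => Re (F (u, v))) x (x + A * s) +
    RInt (fun u => Re (F (u, v))) (x + A * s) (x + A * s + A * s)).
  { intros v Hv. symmetry. apply (RInt_Chasles (V := R_CompleteNormedModule));
    apply ex_RInt_Re_horizontal; lra. }
  assert (Cv : forall u, x0 <= u <= x0 + A ->
    RInt (fun v => Im (F (u, v))) y (y + B * s + B * s) =
    RInt (fun v => Im (F (u, v))) y (y + B * s) +
    RInt (fun v => Im (F (u, v))) (y + B * s) (y + B * s + B * s)).
  { intros v Hv. symmetry. apply (RInt_Chasles (V := R_CompleteNormedModule));
    apply ex_RInt_Im_vertical; lra. }
  rewrite !Ch, !Cv by lra. ring.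
Qed.

(** Near [(p, q)], [F] is affine up to an error [o(t)]. The affine part integrates to zero around
    the rectangle, and the error is integrated along sides of length [O(t)]. *)
Lemma rect_int_local (p q eta : R) :
  x0 <= p <= x0 + A * 1 -> y0 <= q <= y0 + B * 1 -> 0 < eta ->
  exists d, 0 < d /\ forall x y t, 0 < t < d -> subrect A B x0 y0 1 x y t ->
    x <= p <= x + A * t -> y <= q <= y + B * t ->
    Rabs (rect_int F A B x y t) <= eta * (t * t).
Proof.
  intros Hp Hq He.
  destruct (cdiff_linear_approx F (p, q)) as [l Hl]; [apply hF; lra|].
  set (k := A + B). assert (Hk : 0 < k) by (unfold k; lra).
  (* Both integrands are differences of two values, each within [eps t k] of the affine part. The
     total error is thus [2 (eps t k) (k t)], which is [eta t^2] for this [eps]. *)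
  set (eps := eta / (2 * (k * k))).
  assert (Hkk : 0 < k * k) by now apply Rmult_lt_0_compat.
  assert (Heps : 0 < eps) by (apply Rdiv_lt_0_compat; lra).
  destruct (Hl eps Heps) as [d [Hd H]].
  exists (d / k). split; [now apply Rdiv_lt_0_compat|].
  intros x y t [Ht Htd] [H1 [H2 [H3 H4]]] Hx Hy.
  assert (Htk : t * k < d) by (apply Rlt_div_r in Htd; lra).
  assert (HAt : 0 < A * t) by now apply Rmult_lt_0_compat.
  assert (HBt : 0 < B * t) by now apply Rmult_lt_0_compat.
  set (e := eps * (t * k)).
  assert (Key : forall u v, x <= u <= x + A * t -> y <= v <= y + B * t ->
    Cmod (F (u, v) - F (p, q) - l * ((u - p)%R, (v - q)%R))%C <= e).
  { intros u v Hu Hv.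
    assert (M : Cmod (u - p, v - q) <= t * k).
    { eapply Rle_trans; [apply Cmod_pair_le|]. unfold k.
      assert (Rabs (u - p) <= A * t) by (apply Rabs_le; lra).
      assert (Rabs (v - q) <= B * t) by (apply Rabs_le; lra). lra. }
    specialize (H (u, v)).
    replace ((u, v) - (p, q))%C with ((u - p, v - q) : C) in H
      by (unfold Cminus, Cplus, Copp; simpl; f_equal; ring).
    specialize (H (Rle_lt_trans _ _ _ M Htk)).
    eapply Rle_trans; [exact H|]. apply Rmult_le_compat_l; lra. }
  destruct l as [al be].
  assert (KR : forall u v, x <= u <= x + A * t -> y <= v <= y + B * t ->
    Rabs (Re (F (u, v)) - Re (F (p, q)) - (al * (u - p) - be * (v - q))) <= e).
  { intros u v Hu Hv. eapply Rle_trans; [|exact (Key u v Hu Hv)].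
    apply (re_le_Cmod (F (u, v) - F (p, q) - (al, be) * ((u - p)%R, (v - q)%R))%C). }
  assert (KI : forall u v, x <= u <= x + A * t -> y <= v <= y + B * t ->
    Rabs (Im (F (u, v)) - Im (F (p, q)) - (al * (v - q) + be * (u - p))) <= e).
  { intros u v Hu Hv. eapply Rle_trans; [|exact (Key u v Hu Hv)].
    apply (Rabs_Im_le_Cmod (F (u, v) - F (p, q) - (al, be) * ((u - p)%R, (v - q)%R))%C). }
  unfold rect_int.
  set (I1 := RInt _ _ _). set (I2 := RInt _ _ _).
  assert (B1 : Rabs (I1 - (be * (B * t)) * (x + A * t - x)) <= (2 * e) * (x + A * t - x)).
  { apply RInt_const_approx; [lra| |].
    - apply (ex_RInt_minus (V := R_NormedModule)); apply ex_RInt_Re_horizontal; lra.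
    - intros u Hu.
      pose proof (proj1 (Rabs_le_between _ _) (KR u y ltac:(lra) ltac:(lra))).
      pose proof (proj1 (Rabs_le_between _ _) (KR u (y + B * t) ltac:(lra) ltac:(lra))).
      apply Rabs_le. lra. }
  assert (B2 : Rabs (I2 - (be * (A * t)) * (y + B * t - y)) <= (2 * e) * (y + B * t - y)).
  { apply RInt_const_approx; [lra| |].
    - apply (ex_RInt_minus (V := R_NormedModule)); apply ex_RInt_Im_vertical; lra.
    - intros v Hv.
      pose proof (proj1 (Rabs_le_between _ _) (KI x v ltac:(lra) ltac:(lra))).
      pose proof (proj1 (Rabs_le_between _ _) (KI (x + A * t) v ltac:(lra) ltac:(lra))).
      apply Rabs_le. lra. }
  apply Rabs_le_between in B1. apply Rabs_le_between in B2.
  replace (eta * (t * t)) with (2 * e * (A * t) + 2 * e * (B * t)).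
  2:{ unfold e, eps, k. field. unfold k in Hk. lra. }
  apply Rabs_le.
  (* The affine parts of [I1] and [I2] are both [be] times the area and cancel in [I1 - I2]. *)
  replace (be * (B * t) * (x + A * t - x)) with (be * (A * t) * (y + B * t - y)) in B1 by ring.
  lra.
Qed.

(** The bound [eta t^2] is stable under splitting, because [4 s^2 = (2 s)^2], and holds locally.
    Bisection gives it at scale 1, where with [eta] half the modulus of the integral it is
    absurd. *)
Theorem goursat : rect_int F A B x0 y0 1 = 0.
Proof.
  apply NNPP. intros N. apply Rabs_pos_lt in N.
  set (eta := Rabs (rect_int F A B x0 y0 1) / 2).
  assert (He : 0 < eta) by (unfold eta; lra).
  assert (X : Rabs (rect_int F A B x0 y0 1) <= eta * (1 * 1)).
  { apply (bisection A B x0 y0 1 (fun x y t => Rabs (rect_int F A B x y t) <= eta * (t * t)));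
      auto; [lra| |].
    - intros x y s Hs Hsub Q1 Q2 Q3 Q4. rewrite rect_int_split by auto.
      eapply Rle_trans; [apply Rabs_triang|].
      eapply Rle_trans; [apply Rplus_le_compat_r, Rabs_triang|].
      eapply Rle_trans; [apply Rplus_le_compat_r, Rplus_le_compat_r, Rabs_triang|].
      lra.
    - intros p q Hp Hq. now apply rect_int_local. }
  unfold eta in X. lra.
Qed.

End Goursat.

(** * Bounded functions on the disc and on the half-plane *)

(* In the coordinate [log z] the two horizontal sides of the rectangle cancel by
   periodicity, so Goursat's lemma makes circular means independent of the radius. *)
Lemma circle_mean_Im (H : C -> C) (x0 x1 : R) : x0 < x1 -> x1 < 0 ->
  (forall z, Cmod z < 1 -> cdiff H z) ->
  ex_RInt (fun v => Im (H (Cexp' (x1, v))) - Im (H (Cexp' (x0, v)))) 0 (2 * PI) /\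
  RInt (fun v => Im (H (Cexp' (x1, v))) - Im (H (Cexp' (x0, v)))) 0 (2 * PI) = 0.
Proof.
  intros H01 H1 HH. set (F := fun z => H (Cexp' z)).
  pose proof PI_RGT_0 as Hpi.
  assert (DF : forall u v, u <= x1 -> cdiff F (u, v)).
  { intros u v Hu. apply (cdiff_comp H Cexp'); [apply cdiff_Cexp'|].
    apply HH. rewrite Cmod_Cexp'. simpl. rewrite <- exp_0. apply exp_increasing. lra. }
  assert (HA : 0 < x1 - x0) by lra. assert (HB : 0 < 2 * PI) by lra.
  assert (DF' : forall u v, x0 <= u <= x0 + (x1 - x0) -> 0 <= v <= 0 + 2 * PI ->
    cdiff F (u, v)) by (intros; apply DF; lra).
  split.
  - apply (ex_RInt_minus (V := R_NormedModule)
      (fun v => Im (F (x1, v))) (fun v => Im (F (x0, v))));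
      apply (ex_RInt_Im_vertical F (x1 - x0) (2 * PI) x0 0 DF'); lra.
  - pose proof (goursat F (x1 - x0) (2 * PI) x0 0 HA HB DF') as G.
    unfold rect_int in G.
    rewrite (RInt_ext (fun u => Re (F (u, 0)) - Re (F (u, 0 + 2 * PI * 1)))
      (fun _ => 0)) in G.
    2:{ intros u _. unfold F, Cexp'; simpl. rewrite Rplus_0_l, Rmult_1_r.
        rewrite cos_2PI, sin_2PI, cos_0, sin_0. ring. }
    rewrite RInt_const in G. unfold scal in G; simpl in G. unfold mult in G; simpl in G.
    rewrite !Rmult_1_r, Rplus_0_l in G.
    replace (x0 + (x1 - x0)) with x1 in G by ring.
    change (RInt (fun v => Im (F (x1, v)) - Im (F (x0, v))) 0 (2 * PI) = 0). lra.
Qed.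

(** Suppose [h = |H 0| > M]. The factor [c = i conj (H 0)] makes [Im (c H 0) = h^2]. On a tiny
    circle [Im (c H)] is at least [h^2 - h e]; on the circle of radius [r] it is at most
    [h M = h^2 - 2 h e]. The means over the two circles agree, a contradiction. *)
Lemma disk_center_bound (H : C -> C) (r M : R) : 0 < r < 1 ->
  (forall z, Cmod z < 1 -> cdiff H z) ->
  (forall z, Cmod z = r -> Cmod (H z) <= M) -> Cmod (H 0) <= M.
Proof.
  intros Hr HH HM. apply Rnot_lt_le. intros N.
  set (h := Cmod (H 0)) in *.
  assert (HM0 : 0 <= M).
  { eapply Rle_trans; [apply Cmod_ge_0|]. apply (HM (RtoC r)).
    rewrite Cmod_R, Rabs_pos_eq; lra. }
  set (e := (h - M) / 2). assert (He : 0 < e) by (unfold e; lra).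
  assert (D0 : cdiff H 0) by (apply HH; rewrite Cmod_0; lra).
  destruct (cdiff_ccont _ _ D0 e He) as [d [Hd Hd1]].
  set (c := (Ci * Cconj (H 0%C))%C).
  assert (Hc : Cmod c = h) by (unfold c; rewrite Cmod_mult, Cmod_Ci, Cmod_conj; unfold h; ring).
  set (x1 := ln r).
  assert (Hx1 : x1 < 0) by (unfold x1; rewrite <- ln_1; apply ln_increasing; lra).
  (* The inner circle must have a smaller radius than [r] and lie within [d] of the centre. *)
  set (x0 := Rmin (x1 - 1) (ln d - 1)).
  assert (Hx01 : x0 < x1) by (pose proof (Rmin_l (x1 - 1) (ln d - 1)); unfold x0; lra).
  assert (Hx0d : exp x0 < d).
  { rewrite <- (exp_ln d Hd). apply exp_increasing.
    pose proof (Rmin_r (x1 - 1) (ln d - 1)); unfold x0; lra. }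
  destruct (circle_mean_Im (fun z => c * H z)%C x0 x1 Hx01 Hx1) as [EX E].
  { intros z Hz. apply cdiff_mult; [apply cdiff_const | now apply HH]. }
  pose proof PI_RGT_0 as Hpi.
  assert (U : RInt (fun v => Im (c * H (Cexp' (x1, v)))%C - Im (c * H (Cexp' (x0, v)))%C)
    0 (2 * PI) <= RInt (fun _ => - (h * e)) 0 (2 * PI)).
  { apply RInt_le; [lra | exact EX | apply ex_RInt_const|]. intros v _.
    assert (I1 : Im (c * H (Cexp' (x1, v)))%C <= h * M).
    { eapply Rle_trans; [apply Rle_abs|]. eapply Rle_trans; [apply Rabs_Im_le_Cmod|].
      rewrite Cmod_mult, Hc. apply Rmult_le_compat_l; [lra|].
      apply HM. rewrite Cmod_Cexp'. simpl. unfold x1. rewrite exp_ln; lra. }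
    assert (I0 : h * h - h * e <= Im (c * H (Cexp' (x0, v)))%C).
    { set (w := H (Cexp' (x0, v))).
      replace (c * w)%C with (c * H 0%C + c * (w - H 0%C))%C by ring.
      rewrite im_plus.
      assert (Im (c * H 0%C)%C = h * h).
      { replace (h * h) with (h ^ 2) by ring. unfold h. rewrite Cmod2_alt.
        unfold c. destruct (H 0%C) as [a b]. simpl. ring. }
      assert (HI : Rabs (Im (c * (w - H 0%C))%C) <= h * e).
      { eapply Rle_trans; [apply Rabs_Im_le_Cmod|].
        rewrite Cmod_mult, Hc. apply Rmult_le_compat_l; [lra|]. left. apply Hd1.
        replace (Cexp' (x0, v) - 0)%C with (Cexp' (x0, v)) by ring.
        now rewrite Cmod_Cexp'. }
      apply Rabs_le_between in HI. lra. }
    assert (h * M = h * h - 2 * (h * e)) by (unfold e; field). lra. }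
  rewrite E, RInt_const in U.
  unfold scal in U; simpl in U. unfold mult in U; simpl in U.
  assert (0 < (2 * PI - 0) * (h * e)).
  { apply Rmult_lt_0_compat; [lra|]. apply Rmult_lt_0_compat; lra. }
  lra.
Qed.

Lemma Cmod_sq (x y : R) : Cmod (x, y) ^ 2 = x ^ 2 + y ^ 2.
Proof. apply Cmod2_alt. Qed.

Lemma Cmod_lt_sq (z w : C) : Cmod z ^ 2 < Cmod w ^ 2 -> Cmod z < Cmod w.
Proof.
  intros H. apply Rnot_le_lt. intros N. pose proof (Cmod_ge_0 w).
  assert (Cmod w ^ 2 <= Cmod z ^ 2) by (apply pow_incr; lra). lra.
Qed.

(** The Cayley map of the disc onto the right half-plane that sends the centre to [sig + i t]. *)
Definition disk_to_half (sig t : R) (z : C) : C :=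
  ((0, t) + RtoC sig * ((1 + z) * / (1 + - z)))%C.

Lemma one_minus_neq_0 (z : C) : Cmod z < 1 -> (1 + - z)%C <> 0.
Proof.
  intros H E. assert (z = 1%C) as -> by (replace z with (1 - (1 + - z))%C by ring; rewrite E; ring).
  rewrite Cmod_1 in H. lra.
Qed.

Lemma cdiff_disk_to_half (sig t : R) (z : C) : Cmod z < 1 -> cdiff (disk_to_half sig t) z.
Proof.
  intros H. unfold disk_to_half.
  apply cdiff_plus; [apply cdiff_const|]. apply cdiff_mult; [apply cdiff_const|].
  apply cdiff_mult; [apply cdiff_plus; [apply cdiff_const | apply cdiff_id]|].
  apply (cdiff_inv (fun z => 1 + - z)%C); [|now apply one_minus_neq_0].
  apply cdiff_plus; [apply cdiff_const|].
  apply cdiff_ext_near with (fun w => - (1) * w)%C.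
  - exists 1. split; [lra|]. intros w _. ring.
  - apply cdiff_mult; [apply cdiff_const | apply cdiff_id].
Qed.

Lemma Re_disk_to_half (sig t : R) (z : C) : Cmod z < 1 ->
  Re (disk_to_half sig t z) = sig * (1 - Cmod z ^ 2) / Cmod (1 + - z)%C ^ 2.
Proof.
  intros H. pose proof (one_minus_neq_0 z H) as N.
  apply Cmod_gt_0 in N. destruct z as [x y].
  replace ((1 + - (x, y))%C) with ((1 - x, - y) : C) in *
    by (unfold Cplus, Copp, RtoC; simpl; f_equal; ring).
  assert (N2 : 0 < Cmod (1 - x, - y) ^ 2) by now apply pow_lt.
  unfold disk_to_half.
  replace ((1 + - (x, y))%C) with ((1 - x, - y) : C)
    by (unfold Cplus, Copp, RtoC; simpl; f_equal; ring).
  rewrite !Cmod_sq in *. unfold Cplus, Cmult, Cinv, RtoC, Re; simpl.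
  field. nra.
Qed.

Lemma Re_disk_to_half_pos (sig t : R) (z : C) : 0 < sig -> Cmod z < 1 ->
  0 < Re (disk_to_half sig t z).
Proof.
  intros Hs H. rewrite Re_disk_to_half by exact H.
  pose proof (proj1 (Cmod_gt_0 _) (one_minus_neq_0 z H)).
  pose proof (Cmod_ge_0 z).
  apply Rdiv_lt_0_compat; [|now apply pow_lt].
  apply Rmult_lt_0_compat; [exact Hs|]. nra.
Qed.

(** Measures how far the inverse Blaschke factor exceeds 1. It serves both near the imaginary axis,
    where [Re z] is small, and for the lower bound on the Green function. *)
Lemma Cmod_reflection (z s : C) :
  Cmod (z + Cconj s)%C ^ 2 = Cmod (z - s)%C ^ 2 + 4 * Re z * Re s.
Proof.
  destruct z as [x y], s as [a b]. rewrite !Cmod2_alt. simpl. ring.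
Qed.

(** By [Cmod_reflection] the excess is [4 Re w Re s] with [Re w = sig (1 - |z|^2) / |1 - z|^2]. The
    pole at [z = 1] does no harm: [|w - s| |1 - z|] stays above a positive [d], so the excess
    relative to [|w - s|^2] is [O(1 - |z|^2)], uniformly on the circle. *)
Lemma blaschke_quotient_near_circle (sig t : R) (s : C) (eta : R) :
  0 < sig -> 0 < Re s -> 0 < eta ->
  exists r, 0 < r < 1 /\ forall z, Cmod z = r ->
    0 < Cmod (disk_to_half sig t z - s)%C /\
    Cmod (disk_to_half sig t z + Cconj s)%C <= (1 + eta) * Cmod (disk_to_half sig t z - s)%C.
Proof.
  intros Hsig Hs He. destruct s as [a b]. simpl in Hs.
  (* [(w - s) (1 - z) = P + z Q] for [w = disk_to_half sig t z], and [Cmod P < Cmod Q]. *)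
  set (P := ((sig - a)%R, (t - b)%R) : C). set (Q := ((sig + a)%R, (b - t)%R) : C).
  assert (HPQ : Cmod P < Cmod Q).
  { apply Cmod_lt_sq. unfold P, Q. rewrite !Cmod_sq. nra. }
  pose proof (Cmod_ge_0 P) as HP0.
  set (p := Cmod P) in *. set (q := Cmod Q) in *.
  set (d := (q - p) / 2). assert (Hd : 0 < d) by (unfold d; lra).
  (* The first bound gives [(1 - k) q - p >= d], the second keeps the radius [1 - k] inside
     [(0, 1)], and the third, with [1 - (1 - k)^2 <= 2 k], makes the relative excess at most
     [eta]. *)
  set (k := Rmin (d / q) (Rmin (/ 2) (eta * (d * d) / (8 * sig * a)))).
  assert (Hsa : 0 < 8 * sig * a) by (repeat apply Rmult_lt_0_compat; lra).
  assert (Hdd : 0 < d * d) by now apply Rmult_lt_0_compat.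
  assert (Hk : 0 < k).
  { unfold k. repeat apply Rmin_pos; try lra; apply Rdiv_lt_0_compat; try lra.
    now apply Rmult_lt_0_compat. }
  assert (Hk1 : k * q <= d).
  { assert (X : k <= d / q) by apply Rmin_l. apply Rle_div_r in X; lra. }
  assert (Hk2 : k <= / 2) by (eapply Rle_trans; [apply Rmin_r | apply Rmin_l]).
  assert (Hk3 : k * (8 * sig * a) <= eta * (d * d)).
  { assert (X : k <= eta * (d * d) / (8 * sig * a))
      by (eapply Rle_trans; [apply Rmin_r | apply Rmin_r]).
    apply Rle_div_r in X; lra. }
  exists (1 - k). split; [lra|]. intros z Hz.
  assert (Hz1 : Cmod z < 1) by lra.
  pose proof (one_minus_neq_0 z Hz1) as N.
  pose proof (proj1 (Cmod_gt_0 _) N) as Nm.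
  set (w := disk_to_half sig t z).
  assert (EPQ : (P + z * Q)%C = ((w - (a, b)) * (1 + - z))%C).
  { unfold w, disk_to_half.
    replace P with ((0, t) + RtoC sig - (a, b))%C
      by (unfold P, Cminus, Cplus, Copp, RtoC; simpl; f_equal; ring).
    replace Q with (RtoC sig - (0, t) + (a, b))%C
      by (unfold Q, Cminus, Cplus, Copp, RtoC; simpl; f_equal; ring).
    field. exact N. }
  assert (LB : d <= Cmod (P + z * Q)%C).
  { pose proof (Cmod_sub_triangle (z * Q)%C (- P)%C) as T.
    replace (z * Q - - P)%C with (P + z * Q)%C in T by ring.
    rewrite Cmod_mult, Cmod_opp, Hz in T. fold p q in T. unfold d in *. lra. }
  rewrite EPQ, Cmod_mult in LB.
  set (m := Cmod (w - (a, b))%C) in *. set (n := Cmod (1 + - z)%C) in *.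
  assert (Hm : 0 < m).
  { apply Rnot_le_lt. intros X. assert (m * n <= 0) by nra. lra. }
  split; [exact Hm|].
  (* [|w + conj s|^2 = m^2 + 4 sig a (1 - |z|^2) / n^2 <= (1 + eta) m^2] *)
  apply Rsqr_incr_0_var; [|apply Rmult_le_pos; lra].
  rewrite !Rsqr_pow2, Cmod_reflection. fold m.
  assert (HR : Re w * n ^ 2 = sig * (1 - (1 - k) ^ 2)).
  { unfold w. rewrite Re_disk_to_half by exact Hz1. fold n. rewrite Hz. field. lra. }
  assert (HR2 : 4 * Re w * a * n ^ 2 <= eta * (m * n) ^ 2).
  { replace (4 * Re w * a * n ^ 2) with (4 * a * (Re w * n ^ 2)) by ring. rewrite HR.
    assert (d * d <= (m * n) ^ 2) by nra.
    assert (eta * (d * d) <= eta * (m * n) ^ 2) by (apply Rmult_le_compat_l; lra).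
    assert (4 * a * (sig * (1 - (1 - k) ^ 2)) <= k * (8 * sig * a)) by nra.
    lra. }
  assert (Hn2 : 0 < n ^ 2) by now apply pow_lt.
  assert (HR3 : 4 * Re w * a <= eta * m ^ 2).
  { apply Rmult_le_reg_r with (n ^ 2); [exact Hn2|].
    eapply Rle_trans; [exact HR2|]. right. ring. }
  change (Re (a, b)) with a.
  assert (0 <= m ^ 2) by (apply pow_le; lra).
  assert (0 <= eta * m ^ 2) by (apply Rmult_le_pos; lra).
  assert (0 <= eta * (eta * m ^ 2)) by (apply Rmult_le_pos; lra).
  replace (((1 + eta) * m) ^ 2) with (m ^ 2 + 2 * (eta * m ^ 2) + eta * (eta * m ^ 2)) by ring.
  lra.
Qed.

Lemma pow_1_plus_le_exp (eta : R) (m : nat) : 0 <= eta -> (1 + eta) ^ m <= exp (INR m * eta).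
Proof.
  intros He. induction m as [|m IH]; [simpl; rewrite Rmult_0_l, exp_0; lra|].
  rewrite S_INR, Rmult_plus_distr_r, Rmult_1_l, exp_plus. simpl pow.
  rewrite Rmult_comm. apply Rmult_le_compat; try lra.
  - apply pow_le. lra.
  - apply exp_ineq1_le.
Qed.

(** Were [h = |g (sig + i t)| > 1], transport [g] to the disc with this point at the centre. On a
    circle close to the boundary [|g| <= (1 + eta)^m], hence also at the centre, and [eta] is chosen
    so that this is below [h]. *)
Lemma half_plane_bound_of_blaschke (g : C -> C) (s : C) (m : nat) :
  0 < Re s -> (forall z, 0 < Re z -> cdiff g z) ->
  (forall z, 0 < Re z -> Cmod (g z) * Cmod (z - s)%C ^ m <= Cmod (z + Cconj s)%C ^ m) ->
  forall z, 0 < Re z -> Cmod (g z) <= 1.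
Proof.
  intros Hs Dg Hg [sig t] Hsig. simpl in Hsig.
  apply Rnot_lt_le. intros N. set (h := Cmod (g (sig, t))) in *.
  assert (Hln : 0 < ln h) by (rewrite <- ln_1; apply ln_increasing; lra).
  pose proof (pos_INR m) as Hm.
  (* Then [m eta < (m + 1) eta = ln h], strictly, and [m = 0] is covered. *)
  set (eta := ln h / (INR m + 1)).
  assert (He : 0 < eta) by (apply Rdiv_lt_0_compat; lra).
  destruct (blaschke_quotient_near_circle sig t s eta Hsig Hs He) as [r [Hr H]].
  assert (X : Cmod (g (disk_to_half sig t 0)) <= (1 + eta) ^ m).
  { apply (disk_center_bound (fun z => g (disk_to_half sig t z)) r); auto.
    - intros z Hz. apply (cdiff_comp g (disk_to_half sig t)).
      + now apply cdiff_disk_to_half.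
      + apply Dg. now apply Re_disk_to_half_pos.
    - intros z Hz. destruct (H z Hz) as [H1 H2].
      assert (Hw : 0 < Re (disk_to_half sig t z)) by (apply Re_disk_to_half_pos; lra).
      specialize (Hg _ Hw).
      apply Rmult_le_reg_r with (Cmod (disk_to_half sig t z - s)%C ^ m); [now apply pow_lt|].
      eapply Rle_trans; [exact Hg|]. rewrite <- Rpow_mult_distr.
      apply pow_incr. split; [apply Cmod_ge_0 | exact H2]. }
  replace (disk_to_half sig t 0) with ((sig, t) : C) in X.
  2:{ unfold disk_to_half. replace (1 + - 0)%C with (RtoC 1) by ring.
      unfold Cplus, Cmult, Cinv, RtoC; simpl. f_equal; field. }
  fold h in X.
  assert (exp (INR m * eta) < h).
  { rewrite <- (exp_ln h) at 1 by lra. apply exp_increasing.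
    replace (ln h) with ((INR m + 1) * eta) by (unfold eta; field; lra). lra. }
  pose proof (pow_1_plus_le_exp eta m ltac:(lra)). lra.
Qed.

(** * Dividing out zeros *)

(** Records only divisibility by the [k]-th power of [z - s], a property that passes through
    division by a Blaschke factor of another point. *)
Definition zero_factor (g : C -> C) (s : C) (k : nat) : Prop :=
  exists h, cdiff h s /\ cnear s (fun z => g z = (Cpow (z - s) k * h z)%C).

Lemma add_conj_neq_0 (z s : C) : 0 < Re z -> 0 < Re s -> (z + Cconj s)%C <> 0.
Proof.
  intros Hz Hs E. apply (f_equal Re) in E.
  rewrite re_plus, re_conj, re_RtoC in E. lra.
Qed.

(** Away from [s] the quotient is [g * q]; the local factorization supplies the value at [s] and
    differentiability there. Its bound is [half_plane_bound_of_blaschke]. The last clause, in which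
    [q] is absorbed into the cofactor, allows the other zeros to be divided out in turn. *)
Lemma divide_blaschke (g : C -> C) (s : C) (k : nat) :
  0 < Re s -> (forall z, 0 < Re z -> cdiff g z) -> (forall z, 0 < Re z -> Cmod (g z) <= 1) ->
  zero_factor g s k ->
  exists g1, (forall z, 0 < Re z -> cdiff g1 z) /\ (forall z, 0 < Re z -> Cmod (g1 z) <= 1) /\
    (forall z, 0 < Re z -> (g z * Cpow (z + Cconj s) k = Cpow (z - s) k * g1 z)%C) /\
    (forall p j, p <> s -> zero_factor g p j -> zero_factor g1 p j).
Proof.
  intros Hs Dg Bg [h [Dh Eh]].
  set (q := fun z => (Cpow ((z + Cconj s) * / (z + - s)) k)%C).
  set (g1 := fun z => if Ceq_dec z s then (Cpow (z + Cconj s) k * h z)%C else (g z * q z)%C).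
  assert (E : forall z, (g z * Cpow (z + Cconj s) k = Cpow (z - s) k * g1 z)%C).
  { intros z. unfold g1. destruct (Ceq_dec z s) as [->|n].
    - rewrite (cnear_self _ _ Eh). ring.
    - unfold q. rewrite Cpow_mult_l, Cpow_inv by now apply Cminus_eq_contra.
      change (z + - s)%C with (z - s)%C. field. apply Cpow_nz.
      now apply Cminus_eq_contra. }
  assert (Dq : forall z, z <> s -> cdiff q z).
  { intros z n. apply cdiff_pow. apply cdiff_mult.
    - apply cdiff_plus; [apply cdiff_id | apply cdiff_const].
    - apply (cdiff_inv (fun z => z + - s)%C).
      + apply cdiff_plus; [apply cdiff_id | apply cdiff_const].
      + now apply Cminus_eq_contra. }
  assert (E1 : forall z, z <> s -> cnear z (fun w => (g w * q w)%C = g1 w)).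
  { intros z n. apply cnear_imp with (2 := cnear_neq _ _ n). intros w Hw.
    unfold g1. now destruct (Ceq_dec w s). }
  assert (D1 : forall z, 0 < Re z -> cdiff g1 z).
  { intros z Hz. destruct (Ceq_dec z s) as [->|n].
    - apply cdiff_ext_near with (fun w => (Cpow (w + Cconj s) k * h w)%C).
      + apply cnear_imp with (2 := Eh). intros w Hw. unfold g1.
        destruct (Ceq_dec w s) as [_|n]; [reflexivity|].
        rewrite Hw. unfold q.
        rewrite Cpow_mult_l, Cpow_inv by now apply Cminus_eq_contra.
        change (w + - s)%C with (w - s)%C. field. apply Cpow_nz.
        now apply Cminus_eq_contra.
      + apply cdiff_mult; [|exact Dh]. apply cdiff_pow.
        apply cdiff_plus; [apply cdiff_id | apply cdiff_const].
    - apply cdiff_ext_near with (1 := E1 z n). apply cdiff_mult; auto. }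
  exists g1. repeat split; auto.
  - apply (half_plane_bound_of_blaschke g1 s k Hs D1).
    intros z Hz. rewrite <- !Cmod_pow, <- Cmod_mult, Cmult_comm, <- E, Cmod_mult.
    rewrite <- (Rmult_1_l (Cmod (Cpow (z + Cconj s) k))) at 2.
    apply Rmult_le_compat_r; [apply Cmod_ge_0 | auto].
  - intros p j n [hp [Dp Ep]]. exists (fun z => hp z * q z)%C. split.
    + apply cdiff_mult; auto.
    + apply cnear_imp with (2 := cnear_and _ _ _ Ep (E1 p n)).
      intros w [H1 H2]. rewrite <- H2, H1. ring.
Qed.

(** A lower bound, with an elementary primitive in [t], for the Green function
    [log |(w + conj s) / (w - s)|] of the half-plane at [w = sig + i t]. *)
Definition green_minorant (sig t : R) (s : C) : R :=
  2 * sig * Re s / ((sig + Re s) ^ 2 + (t - Im s) ^ 2).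

(** With [x] the minorant, [Cmod_reflection] gives the squared ratio [1 - 2 x <= exp (- 2 x)]. The
    multiplicative form avoids the logarithm of zero at [w = s]. *)
Lemma blaschke_factor_le_exp (sig t : R) (s : C) : 0 < sig -> 0 < Re s ->
  Cmod ((sig, t) - s)%C <= exp (- green_minorant sig t s) * Cmod ((sig, t) + Cconj s)%C.
Proof.
  intros Hsig Hs.
  set (m := Cmod ((sig, t) + Cconj s)%C).
  assert (Em : m ^ 2 = (sig + Re s) ^ 2 + (t - Im s) ^ 2).
  { unfold m. rewrite Cmod2_alt. destruct s. simpl. ring. }
  assert (Hm : 0 < m) by (apply Cmod_gt_0, add_conj_neq_0; auto).
  apply Rsqr_incr_0_var; [|apply Rmult_le_pos; [left; apply exp_pos | lra]].
  rewrite !Rsqr_pow2.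
  pose proof (Cmod_reflection (sig, t) s) as HR. fold m in HR.
  change (Re (sig, t)) with sig in HR.
  unfold green_minorant. rewrite <- Em.
  set (x := 2 * sig * Re s / m ^ 2).
  assert (Ex : 4 * sig * Re s = 2 * x * m ^ 2) by (unfold x; field; lra).
  replace ((exp (- x) * m) ^ 2) with (exp (- (2 * x)) * m ^ 2).
  2:{ replace (- (2 * x)) with (- x + - x) by ring. rewrite exp_plus. ring. }
  assert (Hm2 : 0 <= m ^ 2) by (apply pow_le; lra).
  pose proof (exp_ineq1_le (- (2 * x))) as H1.
  apply (Rmult_le_compat_r (m ^ 2)) in H1; [|exact Hm2]. lra.
Qed.

Definition weighted_sum (w : C -> R) (l : list (C * nat)) : R :=
  fold_right (fun p acc => INR (snd p) * w (fst p) + acc) 0 l.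

(** Induction on the list with [g] general: the head is divided out and the hypothesis applied to
    the quotient. [NoDup] ensures that the remaining zeros differ from the one removed. *)
Lemma zeros_bound (l : list (C * nat)) : forall g : C -> C,
  (forall z, 0 < Re z -> cdiff g z) -> (forall z, 0 < Re z -> Cmod (g z) <= 1) ->
  NoDup (map fst l) ->
  (forall p, In p l -> 0 < Re (fst p) /\ zero_factor g (fst p) (snd p)) ->
  forall sig t, 0 < sig ->
  Cmod (g (sig, t)) <= exp (- weighted_sum (green_minorant sig t) l).
Proof.
  induction l as [|[s k] l IH]; intros g Dg Bg ND Hl sig t Hsig.
  - simpl. rewrite Ropp_0, exp_0. now apply Bg.
  - destruct (Hl (s, k)) as [Hs Zs]; [now left|]. simpl in Hs, Zs.
    inversion ND as [|? ? Hn ND']; subst.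
    destruct (divide_blaschke g s k Hs Dg Bg Zs) as [g1 [D1 [B1 [E1 Z1]]]].
    assert (X := IH g1 D1 B1 ND').
    assert (Hl1 : forall p, In p l -> 0 < Re (fst p) /\ zero_factor g1 (fst p) (snd p)).
    { intros p Hp. destruct (Hl p) as [Hp1 Hp2]; [now right|]. split; [exact Hp1|].
      apply Z1; [|exact Hp2]. intros E. apply Hn. simpl. rewrite <- E. now apply in_map. }
    specialize (X Hl1 sig t Hsig).
    specialize (E1 (sig, t) Hsig). apply (f_equal Cmod) in E1.
    rewrite !Cmod_mult, !Cmod_pow in E1.
    pose proof (blaschke_factor_le_exp sig t s Hsig Hs) as Bs.
    set (m := Cmod ((sig, t) + Cconj s)%C) in *.
    assert (Hm : 0 < m) by (apply Cmod_gt_0, add_conj_neq_0; auto).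
    simpl. fold (weighted_sum (green_minorant sig t) l).
    set (w := weighted_sum _ l) in *. set (G := green_minorant sig t s) in *.
    apply Rmult_le_reg_r with (m ^ k); [now apply pow_lt|]. rewrite E1.
    replace (- (INR k * G + w)) with (INR k * (- G) + - w) by ring. rewrite exp_plus.
    replace (exp (INR k * - G)) with (exp (- G) ^ k).
    2:{ clear. induction k as [|k IHk]; [simpl; now rewrite Rmult_0_l, exp_0|].
        rewrite S_INR, Rmult_plus_distr_r, Rmult_1_l, exp_plus. simpl. rewrite IHk. ring. }
    replace (exp (- G) ^ k * exp (- w) * m ^ k) with ((exp (- G) * m) ^ k * exp (- w))
      by (rewrite Rpow_mult_distr; ring).
    apply Rmult_le_compat.
    + apply pow_le, Cmod_ge_0.
    + apply Cmod_ge_0.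
    + apply pow_incr. split; [apply Cmod_ge_0 | exact Bs].
    + exact X.
Qed.

(** * Integration along a vertical line *)

Definition green_primitive (sig t : R) (s : C) : R :=
  2 * sig * Re s / (sig + Re s) * atan ((t - Im s) / (sig + Re s)).

Lemma is_derive_green_primitive (sig t : R) (s : C) : 0 < sig -> 0 < Re s ->
  is_derive (fun t => green_primitive sig t s) t (green_minorant sig t s).
Proof.
  intros Hsig Hs. unfold green_primitive, green_minorant.
  set (a := Re s) in *. set (b := Im s).
  assert (H : sig + a <> 0) by lra.
  auto_derive; [exact I|]. unfold Rsqr. field. split; [|lra].
  pose proof (pow_lt (sig + a) 2 ltac:(lra)). pose proof (pow2_ge_0 (t - b)). lra.
Qed.

Lemma is_derive_weighted_green_primitive (sig : R) (l : list (C * nat)) (t : R) :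
  0 < sig -> (forall p, In p l -> 0 < Re (fst p)) ->
  is_derive (fun t => weighted_sum (green_primitive sig t) l) t
    (weighted_sum (green_minorant sig t) l).
Proof.
  intros Hsig. induction l as [|[s k] l IH]; intros Hl; simpl.
  - apply (is_derive_const (V := R_NormedModule)).
  - apply (is_derive_plus (V := R_NormedModule)
      (fun t => INR k * green_primitive sig t s) (fun t => weighted_sum (green_primitive sig t) l)).
    + apply is_derive_scal, is_derive_green_primitive; [exact Hsig|].
      apply (Hl (s, k)). now left.
    + apply IH. intros p Hp. apply Hl. now right.
Qed.

Lemma weighted_sum_le (v w : C -> R) (l : list (C * nat)) :
  (forall p, In p l -> v (fst p) <= w (fst p)) -> weighted_sum v l <= weighted_sum w l.
Proof.
  induction l as [|p l IH]; intros H; simpl; [lra|].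
  apply Rplus_le_compat.
  - apply Rmult_le_compat_l; [apply pos_INR|]. apply H. now left.
  - apply IH. intros q Hq. apply H. now right.
Qed.

Lemma weighted_sum_minus (v w : C -> R) (l : list (C * nat)) :
  weighted_sum (fun s => v s - w s) l = weighted_sum v l - weighted_sum w l.
Proof. induction l as [|p l IH]; simpl; [ring|]. rewrite IH. ring. Qed.

Lemma weighted_sum_scal (c : R) (w : C -> R) (l : list (C * nat)) :
  weighted_sum (fun s => c * w s) l = c * weighted_sum w l.
Proof. induction l as [|p l IH]; simpl; [ring|]. rewrite IH. ring. Qed.

(** As [|Im s| < T], both ends of the widened interval are at distance at least [e T] from [Im s],
    so each arctangent is at least [atan (e T / (sig + S))], uniformly in [s]. *)
Lemma green_primitive_increment (sig S T e : R) (s : C) :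
  0 < sig -> 0 < Re s <= S -> Rabs (Im s) < T -> 0 < e ->
  2 * sig / (sig + S) * (2 * atan (e * T / (sig + S))) * Re s <=
  green_primitive sig ((1 + e) * T) s - green_primitive sig (- ((1 + e) * T)) s.
Proof.
  intros Hsig [Ha HS] Hb He. apply Rabs_lt_between in Hb.
  unfold green_primitive. set (a := Re s) in *. set (b := Im s) in *.
  assert (HT : 0 < e * T) by (apply Rmult_lt_0_compat; lra).
  set (y := e * T / (sig + S)).
  assert (Hy : 0 < y) by (apply Rdiv_lt_0_compat; lra).
  assert (At : forall u, e * T <= u -> atan y <= atan (u / (sig + a))).
  { intros u Hu.
    assert (Hyu : y <= u / (sig + a)).
    { unfold y, Rdiv. apply Rmult_le_compat; try lra.
      - left. apply Rinv_0_lt_compat. lra.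
      - apply Rinv_le_contravar; lra. }
    destruct Hyu as [Hlt| ->]; [left; now apply atan_increasing | lra]. }
  pose proof (At ((1 + e) * T - b) ltac:(lra)) as A1.
  pose proof (At ((1 + e) * T + b) ltac:(lra)) as A2.
  assert (A3 : atan ((- ((1 + e) * T) - b) / (sig + a)) = - atan (((1 + e) * T + b) / (sig + a))).
  { rewrite <- atan_opp. f_equal. field. lra. }
  rewrite A3.
  assert (Hat : 0 < atan y) by (rewrite <- atan_0; now apply atan_increasing).
  assert (Hi : / (sig + S) <= / (sig + a)) by (apply Rinv_le_contravar; lra).
  assert (Hsa : 0 < 2 * sig * a) by (repeat apply Rmult_lt_0_compat; lra).
  assert (Hi0 : 0 < / (sig + S)) by (apply Rinv_0_lt_compat; lra).
  replace (2 * sig / (sig + S) * (2 * atan y) * a)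
    with ((2 * sig * a) * / (sig + S) * (2 * atan y)) by (unfold Rdiv; ring).
  unfold Rdiv at 1 3.
  apply Rle_trans with (2 * sig * a * / (sig + a) * (2 * atan y)).
  - apply Rmult_le_compat_r; [lra|]. apply Rmult_le_compat_l; lra.
  - assert (0 < 2 * sig * a * / (sig + a)) by (apply Rmult_lt_0_compat; lra).
    apply Rle_trans with (2 * sig * a * / (sig + a) *
      (atan (((1 + e) * T - b) / (sig + a)) + atan (((1 + e) * T + b) / (sig + a)))).
    + apply Rmult_le_compat_l; lra.
    + right. ring.
Qed.

Lemma zeros_weight_bound (g : C -> C) (l : list (C * nat)) (sig S T e L : R) :
  (forall z, 0 < Re z -> cdiff g z) -> (forall z, 0 < Re z -> Cmod (g z) <= 1) ->
  0 < sig -> 0 < T -> 0 < e ->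
  (forall t, exp (- L) <= Cmod (g (sig, t))) ->
  NoDup (map fst l) ->
  (forall p, In p l -> 0 < Re (fst p) <= S /\ Rabs (Im (fst p)) < T /\
     zero_factor g (fst p) (snd p)) ->
  2 * sig / (sig + S) * (2 * atan (e * T / (sig + S))) * weighted_sum Re l <=
  2 * ((1 + e) * T) * L.
Proof.
  intros Dg Bg Hsig HT He HL ND Hl.
  set (X := (1 + e) * T). assert (HX : 0 < X) by (apply Rmult_lt_0_compat; lra).
  assert (HD : forall t, is_derive (fun t => weighted_sum (green_primitive sig t) l) t
    (weighted_sum (green_minorant sig t) l)).
  { intros t. apply is_derive_weighted_green_primitive; [exact Hsig|].
    intros p Hp. apply (Hl p Hp). }
  (* The mean value theorem replaces integration: the increment of the primitive over [[-X, X]] is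
     [2 X] times the minorant sum at some [c], which [zeros_bound] limits to [L]. *)
  destruct (MVT_gen (fun t => weighted_sum (green_primitive sig t) l) (- X) X
    (fun t => weighted_sum (green_minorant sig t) l)) as [c [_ Hc]].
  - intros t _. apply HD.
  - intros t _. apply derivable_continuous_pt.
    eexists. apply is_derive_Reals, HD.
  - assert (B : weighted_sum (green_minorant sig c) l <= L).
    { assert (exp (- L) <= exp (- weighted_sum (green_minorant sig c) l)).
      { eapply Rle_trans; [apply (HL c)|]. apply zeros_bound; auto.
        intros p Hp. destruct (Hl p Hp) as [H1 [_ H2]]. split; [apply H1 | exact H2]. }
      apply Rnot_lt_le. intros N. apply Rle_not_lt in H. apply H.
      apply exp_increasing. lra. }
    rewrite <- weighted_sum_scal.
    eapply Rle_trans.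
    + apply (weighted_sum_le _ (fun s => green_primitive sig X s - green_primitive sig (- X) s)).
      intros p Hp. destruct (Hl p Hp) as [H1 [H2 _]].
      now apply green_primitive_increment.
    + rewrite weighted_sum_minus, Hc.
      replace (X - - X) with (2 * X) by ring.
      rewrite Rmult_comm. apply Rmult_le_compat_l; lra.
Qed.

(** * Dirichlet series near [+oo] *)

Lemma Cmod_npow_neg (n : nat) (s : C) : Cmod (npow_neg n s) = exp (- Re s * ln (INR n)).
Proof. unfold npow_neg. now rewrite Cmod_Cexp', re_scal_r, re_opp. Qed.

Lemma npow_neg_1 (s : C) : npow_neg 1 s = RtoC 1.
Proof.
  unfold npow_neg, Cexp'. rewrite re_scal_r, im_scal_r. simpl INR.
  rewrite ln_1, !Rmult_0_r, exp_0, cos_0, sin_0. unfold RtoC. f_equal; ring.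
Qed.

Lemma is_series_terms_bounded (u : nat -> C) (l : C) :
  @is_series C_AbsRing C_NormedModule u l -> exists M, 0 < M /\ forall n, Cmod (u n) <= M.
Proof.
  intros H.
  destruct (@filterlim_bounded C_AbsRing C_NormedModule (sum_n u)) as [M HM].
  { exists l. exact H. }
  change (forall n, Cmod (sum_n u n) <= M) in HM.
  exists (2 * M + 1).
  assert (HM0 : 0 <= M) by (eapply Rle_trans; [apply Cmod_ge_0 | apply (HM O)]).
  split; [lra|]. intros [|n].
  - specialize (HM O). rewrite sum_O in HM. lra.
  - replace (u (S n)) with (sum_n u (S n) - sum_n u n)%C.
    + unfold Cminus. eapply Rle_trans; [apply Cmod_triangle|]. rewrite Cmod_opp.
      pose proof (HM (S n)). pose proof (HM n). lra.
    + rewrite sum_Sn. change (sum_n u n + u (S n) - sum_n u n = u (S n))%C. ring.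
Qed.

(** The majorant telescopes: [1 / (n (n + 1)) = 1 / n - 1 / (n + 1)]. *)
Lemma is_series_tail_le (u : nat -> C) (l : C) (K : R) :
  @is_series C_AbsRing C_NormedModule u l ->
  (forall n, Cmod (u (S n)) <= K / (INR (S n) * INR (S (S n)))) ->
  Cmod (l - u O)%C <= K.
Proof.
  intros H Hu.
  assert (P : forall n, Cmod (sum_n u n - u O)%C <= K * (1 - / INR (S n))).
  { induction n as [|n IH].
    - rewrite sum_O, Cmod_sub_self. simpl. lra.
    - rewrite sum_Sn. change (plus (sum_n u n) (u (S n))) with (sum_n u n + u (S n))%C.
      replace (sum_n u n + u (S n) - u O)%C with ((sum_n u n - u O) + u (S n))%C by ring.
      eapply Rle_trans; [apply Cmod_triangle|].
      eapply Rle_trans; [apply Rplus_le_compat; [exact IH | apply Hu]|].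
      right. rewrite (S_INR (S n)).
      assert (0 < INR (S n)) by (apply lt_0_INR; lia). field. lra. }
  assert (HK : 0 <= K).
  { pose proof (Hu O) as H0. simpl in H0. pose proof (Cmod_ge_0 (u 1%nat)). lra. }
  apply le_epsilon. intros e He.
  pose proof (proj1 (filterlim_locally_ball_norm (K := C_AbsRing) (U := C_NormedModule)
    (F := eventually) (sum_n u) l) H (mkposreal e He)) as [N HN].
  specialize (HN N (Nat.le_refl N)).
  change (Cmod (sum_n u N - l)%C < e) in HN. rewrite Cmod_sub_comm in HN.
  replace (l - u O)%C with ((l - sum_n u N) + (sum_n u N - u O))%C by ring.
  eapply Rle_trans; [apply Cmod_triangle|]. specialize (P N).
  assert (0 < / INR (S N)) by (apply Rinv_0_lt_compat, lt_0_INR; lia).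
  nra.
Qed.

(** Convergence at one point bounds the terms there. Further right, each term with index [N >= 2]
    gains a power of [N] depending on [Re s] alone, so the estimate is uniform in [Im s]. *)
Lemma dirichlet_series_at_infty (f : C -> C) (a : nat -> C) (e : R) :
  dirichlet_series_C0_to_D f a -> 0 < e ->
  exists S, 0 < S /\ forall s, S <= Re s -> Cmod (f s - a 1%nat)%C < e.
Proof.
  intros [_ [_ [kap [Hkap H]]]] He.
  destruct (is_series_terms_bounded _ _ (H (RtoC (kap + 1)) ltac:(simpl; lra)))
    as [M [HM0 HM]].
  set (X := Rmax 0 (ln (2 * M / e) / ln 2)).
  assert (HX0 : 0 <= X) by apply Rmax_l.
  assert (Hln2 : 0 < ln 2) by (rewrite <- ln_1; apply ln_increasing; lra).
  assert (HX : M * exp (- (X * ln 2)) < e).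
  { assert (Hx : ln (2 * M / e) <= X * ln 2).
    { apply Rle_div_l; [exact Hln2 | apply Rmax_r]. }
    assert (HMe : 0 < 2 * M / e) by (apply Rdiv_lt_0_compat; lra).
    assert (Hx2 : 2 * M / e <= exp (X * ln 2)).
    { rewrite <- (exp_ln (2 * M / e)) by exact HMe.
      destruct Hx as [Hx| ->]; [left; now apply exp_increasing | lra]. }
    rewrite exp_Ropp. pose proof (exp_pos (X * ln 2)) as HE.
    apply Rlt_div_l; [exact HE|]. apply Rle_div_l in Hx2; [|exact He]. nra. }
  (* From [kap + 1], where the terms are bounded by [M], two units to the right gain [N^(-2)] for
     summability, and [X] more gain at least the factor [2^(-X)], with [M 2^(-X) < e]. *)
  exists (kap + 3 + X). split; [lra|]. intros s Hs.
  eapply Rle_lt_trans; [|exact HX].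
  replace (a 1%nat) with (a 1%nat * npow_neg 1 s)%C by (rewrite npow_neg_1; ring).
  apply (is_series_tail_le (fun n => a (S n) * npow_neg (S n) s)%C); [apply H; lra|].
  intros n. specialize (HM (S n)). rewrite Cmod_mult, Cmod_npow_neg in *.
  rewrite re_RtoC in HM.
  set (N := INR (S (S n))) in *.
  assert (HN : 2 <= N) by (unfold N; rewrite !S_INR; pose proof (pos_INR n); lra).
  assert (HN1 : N = INR (S n) + 1) by (unfold N; apply S_INR).
  assert (HlN : ln 2 <= ln N).
  { destruct HN as [HN| <-]; [left; apply ln_increasing; lra | lra]. }
  replace (- Re s * ln N) with
    (- (kap + 1) * ln N + (- (ln N + ln N) + - ((Re s - kap - 3) * ln N))) by ring.
  rewrite exp_plus, <- Rmult_assoc.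
  apply Rle_trans with (M * exp (- (ln N + ln N) + - ((Re s - kap - 3) * ln N))).
  { apply Rmult_le_compat_r; [left; apply exp_pos | exact HM]. }
  rewrite exp_plus, exp_Ropp, exp_plus, exp_ln by lra.
  assert (E : exp (- ((Re s - kap - 3) * ln N)) <= exp (- (X * ln 2))).
  { assert (X * ln 2 <= (Re s - kap - 3) * ln N) by (apply Rmult_le_compat; lra).
    destruct (Rle_lt_or_eq_dec _ _ H0) as [Hl|El].
    - left. apply exp_increasing. lra.
    - rewrite El. lra. }
  assert (I : / (N * N) <= / (INR (S n) * N)).
  { assert (0 < INR (S n)) by (apply lt_0_INR; lia).
    apply Rinv_le_contravar; [apply Rmult_lt_0_compat; lra|].
    apply Rmult_le_compat_r; lra. }
  unfold Rdiv. rewrite Rmult_assoc. apply Rmult_le_compat_l; [lra|].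
  rewrite Rmult_comm. apply Rmult_le_compat; auto.
  - left. apply exp_pos.
  - left. apply Rinv_0_lt_compat, Rmult_lt_0_compat; lra.
Qed.

(** * The disc automorphism exchanging [xi] and [0] *)

Definition mobius (xi w : C) : C := ((xi + - w) * / (1 + - (Cconj xi * w)))%C.

Lemma mobius_denominator_neq_0 (xi w : C) :
  Cmod xi < 1 -> Cmod w <= 1 -> (1 + - (Cconj xi * w))%C <> 0.
Proof.
  intros Hxi Hw E.
  assert (X : (Cconj xi * w)%C = 1%C).
  { replace (Cconj xi * w)%C with (1 - (1 + - (Cconj xi * w)))%C by ring. rewrite E. ring. }
  apply (f_equal Cmod) in X. rewrite Cmod_mult, Cmod_conj, Cmod_1 in X.
  pose proof (Cmod_ge_0 xi). pose proof (Cmod_ge_0 w). nra.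
Qed.

(** The squared moduli of denominator and numerator differ by [(1 - |xi|^2) (1 - |w|^2)]. *)
Lemma Cmod_mobius_le_1 (xi w : C) : Cmod xi < 1 -> Cmod w <= 1 -> Cmod (mobius xi w) <= 1.
Proof.
  intros Hxi Hw. pose proof (mobius_denominator_neq_0 xi w Hxi Hw) as N.
  unfold mobius. change (Cmod ((xi + - w) / (1 + - (Cconj xi * w)))%C <= 1).
  rewrite Cmod_div by exact N. apply Rle_div_l; [now apply Cmod_gt_0|].
  rewrite Rmult_1_l. apply Rsqr_incr_0_var; [|apply Cmod_ge_0].
  rewrite !Rsqr_pow2.
  assert (E : Cmod (1 + - (Cconj xi * w))%C ^ 2 =
    Cmod (xi + - w)%C ^ 2 + (1 - Cmod xi ^ 2) * (1 - Cmod w ^ 2)).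
  { rewrite !Cmod2_alt. destruct xi, w. simpl. ring. }
  rewrite E. pose proof (Cmod_ge_0 xi). pose proof (Cmod_ge_0 w).
  assert (0 <= (1 - Cmod xi ^ 2) * (1 - Cmod w ^ 2)) by (apply Rmult_le_pos; nra).
  lra.
Qed.

Lemma cdiff_mobius (xi w : C) : Cmod xi < 1 -> Cmod w <= 1 -> cdiff (mobius xi) w.
Proof.
  intros Hxi Hw.
  assert (Dopp : forall c, cdiff (fun w => - (c * w))%C w).
  { intros c. apply cdiff_ext_near with (fun w => - c * w)%C.
    - exists 1. split; [lra|]. intros; ring.
    - apply cdiff_mult; [apply cdiff_const | apply cdiff_id]. }
  apply cdiff_mult.
  - apply cdiff_plus; [apply cdiff_const|].
    apply cdiff_ext_near with (2 := Dopp 1%C).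
    exists 1. split; [lra|]. intros; ring.
  - apply (cdiff_inv (fun w => 1 + - (Cconj xi * w))%C).
    + apply cdiff_plus; [apply cdiff_const | apply Dopp].
    + now apply mobius_denominator_neq_0.
Qed.

(** The new cofactor is [- h / (1 - conj xi f)], whose denominator does not vanish at [s]. *)
Lemma zero_order_zero_factor_mobius (f : C -> C) (xi s : C) (k : nat) :
  Cmod xi < 1 -> cdiff f s -> Cmod (f s) <= 1 ->
  zero_order (fun z => (f z - xi)%C) s k -> zero_factor (fun z => mobius xi (f z)) s k.
Proof.
  intros Hxi Df Bf [h [Dh [_ Eh]]].
  apply locally_cnear in Dh. apply locally_cnear in Eh.
  apply cnear_self, C_differentiable_cdiff in Dh.
  exists (fun z => h z * - / (1 + - (Cconj xi * f z)))%C. split.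
  - apply cdiff_mult; [exact Dh|].
    apply cdiff_ext_near with (fun z => - (1) * / (1 + - Cconj xi * f z))%C.
    + exists 1. split; [lra|]. intros z _.
      replace (- Cconj xi * f z)%C with (- (Cconj xi * f z))%C by ring. ring.
    + apply cdiff_mult; [apply cdiff_const|].
      apply (cdiff_inv (fun z => 1 + - Cconj xi * f z)%C).
      * apply cdiff_plus; [apply cdiff_const|].
        apply cdiff_mult; [apply cdiff_const | exact Df].
      * replace (- Cconj xi * f s)%C with (- (Cconj xi * f s))%C by ring.
        now apply mobius_denominator_neq_0.
  - apply cnear_imp with (2 := Eh). intros z Hz. unfold mobius.
    replace (xi + - f z)%C with (- (f z - xi))%C by ring. rewrite Hz. ring.
Qed.

(** A limit of points of the open disc lies in the closed disc, which is why the lemmas on [mobius]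
    admit [Cmod w <= 1]. *)
Lemma Cmod_f_at_infty_le_1 (f : C -> C) (a : nat -> C) :
  dirichlet_series_C0_to_D f a -> Cmod (f_at_infty a) <= 1.
Proof.
  intros Hf. apply le_epsilon. intros e He.
  destruct (dirichlet_series_at_infty f a e Hf He) as [S [HS H]].
  specialize (H (RtoC S) ltac:(simpl; lra)).
  destruct Hf as [_ [Bf _]]. specialize (Bf (RtoC S) HS).
  pose proof (Cmod_sub_triangle (a 1%nat) (f (RtoC S))) as T. rewrite Cmod_sub_comm in T.
  unfold f_at_infty. lra.
Qed.

(** The logarithm is [- ln |mobius xi c|] with [c = f(+oo)]. The strict inequality leaves room for
    continuity of [mobius xi] at [c] and uniform convergence of [f] to [c]. *)
Lemma mobius_dirichlet_lower_bound (f : C -> C) (a : nat -> C) (xi : C) (L : R) :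
  dirichlet_series_C0_to_D f a -> Cmod xi < 1 -> xi <> f_at_infty a ->
  ln (Cmod (1 - Cconj xi * f_at_infty a)%C / Cmod (xi - f_at_infty a)%C) < L ->
  exists S, 0 < S /\ forall s, S <= Re s -> exp (- L) < Cmod (mobius xi (f s)).
Proof.
  intros Hf Hxi Hne HL.
  pose proof (Cmod_f_at_infty_le_1 f a Hf) as Ha.
  set (c := f_at_infty a) in *.
  pose proof (mobius_denominator_neq_0 xi c Hxi Ha) as N.
  pose proof (proj1 (Cmod_gt_0 _) N) as N1.
  pose proof (proj1 (Cmod_gt_0 _) (Cminus_eq_contra _ _ Hne)) as N2.
  assert (E : exp (- L) < Cmod (mobius xi c)).
  { unfold mobius. change (exp (- L) < Cmod ((xi - c) / (1 + - (Cconj xi * c)))%C).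
    rewrite Cmod_div by exact N.
    change (1 + - (Cconj xi * c))%C with (1 - Cconj xi * c)%C in *.
    rewrite <- (exp_ln (Cmod (xi - c)%C / Cmod (1 - Cconj xi * c)%C))
      by now apply Rdiv_lt_0_compat.
    apply exp_increasing. rewrite ln_div in * by assumption. lra. }
  set (e := Cmod (mobius xi c) - exp (- L)).
  assert (He : 0 < e) by (unfold e; lra).
  destruct (cdiff_ccont _ _ (cdiff_mobius xi c Hxi Ha) e He) as [d [Hd H]].
  destruct (dirichlet_series_at_infty f a d Hf Hd) as [S [HS HfS]].
  exists S. split; [exact HS|]. intros s Hs.
  specialize (H (f s) (HfS s Hs)).
  pose proof (Cmod_sub_triangle (mobius xi c) (mobius xi (f s))) as T.
  rewrite Cmod_sub_comm in T. unfold e in H. lra.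
Qed.

(** * The bound for finite sums over zeros *)

(** Three factors [1 + k] are lost: in widening the interval, in [sig / (sig + S)], and in the
    arctangent. The parameters are fixed in the order [M], [S], [k], [sig], [T0], so [T0] does not
    depend on the chosen zeros. *)
Lemma finite_weighted_sum_bound (f : C -> C) (a : nat -> C) (xi : C) (L eta : R) :
  dirichlet_series_C0_to_D f a -> Cmod xi < 1 -> xi <> f_at_infty a ->
  L = ln (Cmod (1 - Cconj xi * f_at_infty a)%C / Cmod (xi - f_at_infty a)%C) -> 0 < eta ->
  exists T0, 0 < T0 /\ forall T x, T0 <= T -> finite_weighted_sum f xi T x ->
    PI / T * x <= L + eta.
Proof.
  intros Hf Hxi Hne EL Heta.
  pose proof Hf as [Df [Bf _]].
  set (g := fun z => mobius xi (f z)).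
  assert (Dg : forall z, 0 < Re z -> cdiff g z).
  { intros z Hz. apply (cdiff_comp (mobius xi) f).
    - now apply C_differentiable_cdiff, Df.
    - apply cdiff_mobius; [exact Hxi|]. left. now apply Bf. }
  assert (Bg : forall z, 0 < Re z -> Cmod (g z) <= 1).
  { intros z Hz. apply Cmod_mobius_le_1; [exact Hxi|]. left. now apply Bf. }
  set (M := L + eta / 2).
  destruct (mobius_dirichlet_lower_bound f a xi M Hf Hxi Hne) as [S [HS HgS]].
  { rewrite <- EL. unfold M. lra. }
  assert (HM : 0 < M).
  { specialize (HgS (RtoC S) ltac:(simpl; lra)). specialize (Bg (RtoC S) HS).
    unfold g in Bg. apply Rnot_le_lt. intros X.
    assert (exp 0 <= exp (- M)).
    { destruct X as [X| ->]; [left; apply exp_increasing; lra | rewrite Ropp_0; lra]. }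
    rewrite exp_0 in H. lra. }
  (* [k] satisfies [(1 + k)^3 * M <= M + eta / 2] *)
  set (k := Rmin 1 (eta / (14 * M))).
  assert (Hk : 0 < k) by (apply Rmin_pos; [lra | apply Rdiv_lt_0_compat; lra]).
  assert (Hk1 : k <= 1) by apply Rmin_l.
  assert (Hk2 : 7 * k * M <= eta / 2).
  { assert (X : k <= eta / (14 * M)) by apply Rmin_r. apply Rle_div_r in X; lra. }
  (* Large enough that [sig / (sig + S) >= 1 / (1 + k)]. *)
  set (sig := S + S / k).
  assert (HSk : 0 < S / k) by now apply Rdiv_lt_0_compat.
  assert (Hsig : 0 < sig) by (unfold sig; lra).
  assert (HsigS : sig + S <= (1 + k) * sig).
  { assert (S / k * k = S) by (field; lra).
    assert (0 < k * S) by now apply Rmult_lt_0_compat. unfold sig. lra. }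
  pose proof PI_RGT_0 as Hpi.
  (* The fraction [1 / (1 + k)] of the limit [PI / 2] of the arctangent. *)
  set (th := PI / 2 / (1 + k)).
  assert (Hth : 0 < th) by (apply Rdiv_lt_0_compat; lra).
  assert (Hth2 : th < PI / 2).
  { unfold th. apply Rlt_div_l; [lra|].
    assert (0 < PI / 2 * k) by (apply Rmult_lt_0_compat; lra). lra. }
  assert (exists y, 0 < y /\ atan y = th) as [y [Hy Ey]].
  { exists (tan th). split; [now apply tan_gt_0 | apply atan_tan; lra]. }
  (* From this [T] on, [k T / (sig + S) >= y], hence its arctangent is at least [th]. *)
  exists (y * (sig + S) / k). split.
  { apply Rdiv_lt_0_compat; [apply Rmult_lt_0_compat; lra | exact Hk]. }
  intros T x HT [l [ND [Hl ->]]]. fold (weighted_sum Re l).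
  set (W := weighted_sum Re l).
  assert (HkT : y <= k * T / (sig + S)).
  { apply Rle_div_r; [lra|]. apply Rle_div_l in HT; lra. }
  assert (HT0 : 0 < T).
  { apply Rlt_le_trans with (2 := HT). apply Rdiv_lt_0_compat; [|exact Hk].
    apply Rmult_lt_0_compat; lra. }
  assert (Hat : th <= atan (k * T / (sig + S))).
  { rewrite <- Ey.
    destruct HkT as [HkT| <-]; [left; now apply atan_increasing | lra]. }
  assert (HW : 0 <= W).
  { replace 0 with (weighted_sum (fun _ => 0) l).
    - apply weighted_sum_le. intros p Hp. left. apply (Hl p Hp).
    - clear. induction l as [|p l IH]; simpl; [reflexivity|]. rewrite IH. ring. }
  pose proof (zeros_weight_bound g l sig S T k M Dg Bg Hsig HT0 Hk) as Z.
  assert (Zb : 2 * sig / (sig + S) * (2 * atan (k * T / (sig + S))) * W <=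
    2 * ((1 + k) * T) * M).
  { apply Z; auto.
    - intros t. left. apply HgS. simpl. unfold sig. lra.
    - intros p Hp. destruct (Hl p Hp) as [H1 [H2 [H3 H4]]].
      split; [|split; [exact H2|]].
      (* No zero has real part beyond [S], since [|g| > exp (- M) > 0] there. *)
      + split; [exact H1|]. apply Rnot_lt_le. intros X.
        assert (Y := HgS (fst p) ltac:(lra)). rewrite H3 in Y. unfold mobius in Y.
        replace (xi + - xi)%C with (RtoC 0) in Y by ring.
        rewrite Cmult_0_l, Cmod_0 in Y. pose proof (exp_pos (- M)). lra.
      + apply zero_order_zero_factor_mobius; auto.
        * now apply C_differentiable_cdiff, Df.
        * left. now apply Bf. }
  assert (Zc : 2 / (1 + k) * (2 * th) <= 2 * sig / (sig + S) * (2 * atan (k * T / (sig + S)))).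
  { apply Rmult_le_compat; try lra.
    - left. apply Rdiv_lt_0_compat; lra.
    - apply Rmult_le_reg_r with ((1 + k) * (sig + S)); [apply Rmult_lt_0_compat; lra|].
      replace (2 / (1 + k) * ((1 + k) * (sig + S))) with (2 * (sig + S)) by (field; lra).
      replace (2 * sig / (sig + S) * ((1 + k) * (sig + S))) with (2 * ((1 + k) * sig))
        by (field; lra).
      lra. }
  assert (Zd : 2 * PI / ((1 + k) * (1 + k)) * W <= 2 * ((1 + k) * T) * M).
  { eapply Rle_trans; [|exact Zb]. apply Rmult_le_compat_r; [exact HW|].
    eapply Rle_trans; [|exact Zc]. right. unfold th. field. lra. }
  assert (Hkk : 0 < (1 + k) * (1 + k)) by (apply Rmult_lt_0_compat; lra).
  assert (Ze : PI * W <= (1 + k) ^ 3 * T * M).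
  { apply (Rmult_le_compat_r ((1 + k) * (1 + k))) in Zd; [|lra].
    replace (2 * PI / ((1 + k) * (1 + k)) * W * ((1 + k) * (1 + k)))
      with (2 * (PI * W)) in Zd by (field; lra).
    lra. }
  replace (PI / T * W) with (PI * W / T) by (field; lra).
  apply Rle_div_l; [exact HT0|]. eapply Rle_trans; [exact Ze|].
  replace ((1 + k) ^ 3 * T * M) with ((1 + k) ^ 3 * M * T) by ring.
  apply Rmult_le_compat_r; [lra|].
  assert (K3 : (1 + k) ^ 3 <= 1 + 7 * k).
  { assert (k * k <= k) by nra. assert (k * k * k <= k) by nra. simpl. lra. }
  apply (Rmult_le_compat_r M) in K3; [|lra]. unfold M in *. lra.
Qed.

(** * Suprema and upper limits in the extended reals *)

Lemma limsup_pinfty_le (F : R -> Rbar) (L : R) :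
  (forall eta, 0 < eta -> exists T0, forall T, T0 <= T -> Rbar_le (F T) (L + eta)) ->
  Rbar_le (limsup_pinfty F) L.
Proof.
  intros H. unfold limsup_pinfty, Rbar_glb.
  destruct (Rbar_ex_glb _) as [m [Hm Hm']]; simpl; clear Hm'.
  assert (X : forall eta, 0 < eta -> Rbar_le m (L + eta)).
  { intros eta He. destruct (H eta He) as [T0 HT0].
    eapply Rbar_le_trans.
    - apply Hm. exists T0. reflexivity.
    - unfold Rbar_lub. destruct (Rbar_ex_lub _) as [b [Hb' Hb]]; simpl.
      apply Hb. intros z [T [HT ->]]. now apply HT0. }
  destruct m as [m| |]; simpl; auto.
  - apply le_epsilon. intros e He. exact (X e He).
  - exact (X 1 Rlt_0_1).
Qed.

(** The empty list; it excludes the value [m_infty] for the supremum in [N_f]. *)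
Lemma finite_weighted_sum_0 (f : C -> C) (xi : C) (T : R) : finite_weighted_sum f xi T 0.
Proof. exists nil. split; [constructor|]. split; [intros p [] | reflexivity]. Qed.

Lemma N_f_le (f : C -> C) (xi : C) (T b : R) : 0 < T ->
  (forall x, finite_weighted_sum f xi T x -> PI / T * x <= b) -> Rbar_le (N_f f xi T) b.
Proof.
  intros HT H. unfold N_f.
  assert (Hc : 0 < PI / T) by (apply Rdiv_lt_0_compat; [apply PI_RGT_0 | exact HT]).
  destruct (Lub_Rbar_correct (finite_weighted_sum f xi T)) as [L1 L2].
  assert (U : Rbar_le (Lub_Rbar (finite_weighted_sum f xi T)) (b / (PI / T))).
  { apply L2. intros x Hx. simpl. apply Rle_div_r; [exact Hc|].
    rewrite Rmult_comm. now apply H. }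
  specialize (L1 0 (finite_weighted_sum_0 f xi T)).
  destruct (Lub_Rbar _) as [r| |]; [|contradiction|contradiction].
  simpl in *. apply Rle_div_r in U; lra.
Qed.

Theorem theorem5p4 (f : C -> C) (a : nat -> C) (xi : C) :
  dirichlet_series_C0_to_D f a ->
  Cmod xi < 1 ->
  xi <> f_at_infty a ->
  Rbar_le (limsup_pinfty (N_f f xi))
    (Finite (ln (Cmod (Cminus (RtoC 1) (Cmult (Cconj xi) (f_at_infty a)))
                 / Cmod (Cminus xi (f_at_infty a))))).
Proof.
  intros Hf Hxi Hne. apply limsup_pinfty_le. intros eta He.
  destruct (finite_weighted_sum_bound f a xi _ eta Hf Hxi Hne eq_refl He) as [T0 [HT0 H]].
  exists T0. intros T HT. apply N_f_le; [lra|]. intros x. now apply H.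
Qed.
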